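(* Let $\mu$ and $\nu$ be two probability measures on the real line, where $\nu$ is absolutely continuous. The following conditions are equivalent: (a) $\mu \leq_{cx} \nu$; (b) there exist real random variables $X$ and $Y$, defined on a common probability space, with marginal distributions $\mu$ and $\nu$ respectively, such that $\mathrm{E}(Y \mid X) = X$ and, with $\mu$-probability one, the conditional distribution of $Y$ given $X$ is either singular (i.e. $Y = X$) or absolutely continuous.
   Context: For two random variables $X$ and $Y$ with probability measures $\mu$ and $\nu$, we write $\mu \leq_{cx} \nu$ (equivalently $X \leq_{cx} Y$, ''$X$ is less variable than $Y$ in the convex order'') if $\mathrm{E}\{h(X)\} \leq \mathrm{E}\{h(Y)\}$ for every convex function $h:\mathbb{R}\to\mathbb{R}$ for which the expectations exist.
   Formalization: The formal theorem additionally assumes that μ and ν have finite first moments; without this, (a) does not imply (b), e.g. for μ a point mass at 0 and ν the Cauchy law. The convex order is tested on convex h integrable under both measures. *)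

(* Defs.v *)
From HB Require Import structures.
From mathcomp Require Import all_boot all_order all_algebra.
From mathcomp Require Import all_classical all_reals all_analysis.
Set Implicit Arguments.
Unset Strict Implicit.
Unset Printing Implicit Defensive.
Import Order.TTheory GRing.Theory Num.Theory.
Import numFieldNormedType.Exports.
Local Open Scope classical_set_scope.
Local Open Scope ring_scope.

Definition convex_fun (R : realType) (h : R -> R) : Prop :=
  forall (x y t : R), 0 <= t -> t <= 1 ->
    h (t * x + (1 - t) * y) <= t * h x + (1 - t) * h y.

(* mu <=_cx nu : E h(X) <= E h(Y) for every convex h for which the
   expectations exist (read: h is integrable w.r.t. mu and nu). *)
Definition convex_order (R : realType) (mu nu : probability R R) : Prop :=
  forall h : R -> R, convex_fun h ->
    mu.-integrable setT (EFin \o h) ->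
    nu.-integrable setT (EFin \o h) ->
    (\int[mu]_x (h x)%:E <= \int[nu]_x (h x)%:E)%E.

Definition same_measure (R : realType) (m1 m2 : set R -> \bar R) : Prop :=
  forall A : set R, measurable A -> m1 A = m2 A.

(* E(Y | X) = X : X and Y are integrable and, for every Borel A,
   E[Y ; X \in A] = E[X ; X \in A] (defining property of the conditional
   expectation of Y given sigma(X), X being sigma(X)-measurable). *)
Definition cond_exp_is_X d (T : measurableType d) (R : realType)
    (P : probability T R) (X Y : {mfun T >-> R}) : Prop :=
  P.-integrable setT (EFin \o X) /\ P.-integrable setT (EFin \o Y) /\
  forall A : set R, measurable A ->
    (\int[P]_(w in X @^-1` A) (Y w)%:E = \int[P]_(w in X @^-1` A) (X w)%:E)%E.

Definition cond_distribution d (T : measurableType d) (R : realType)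
    (P : probability T R) (X Y : {mfun T >-> R}) (K : R.-pker R ~> R) : Prop :=
  forall A B : set R, measurable A -> measurable B ->
    P (X @^-1` A `&` Y @^-1` B) = (\int[P]_(w in X @^-1` A) K (X w) B)%E.

(* Main.v *)
(** Let [T] be the nondecreasing map with [T_* nu = mu] and [u = T - id].  Testing
    the convex order on [x |-> max (k - x) 0] shows that the measures [u^+ nu]
    and [u^- nu], which have equal mass, satisfy the reverse inequality of
    distribution functions, so that their monotone transport [S] moves mass to
    the right: [y < T y <= T (S y) < S y] almost everywhere.  Choosing rationals
    [q], [r] with [y < q < T y] and [T (S y) < r < S y] splits [nu], off the
    fixed points of [T], into countably many pairs [al_n + be_n] of absolutely
    continuous measures with barycentre equal to that of the image
    [T_* (al_n + be_n)], where [al_n] lives on the left of [q_n], [be_n] on the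
    right of [r_n] and the image in between.  A point [x] of [`]q_n, r_n[] is the
    barycentre of [l x al_n + s x be_n] for affine positive weights [l], [s];
    mixing these over [n] with the densities of [T_* (al_n + be_n)] with respect
    to [mu] gives an absolutely continuous martingale kernel, to be completed
    with Dirac masses at the fixed points of [T].

    Conversely a convex function is, up to [e], a countable supremum of tangents;
    partitioning the values of [X] according to the first good tangent reduces
    Jensen's inequality to affine functions. *)
Require Import Defs.
From HB Require Import structures.
From mathcomp Require Import all_boot all_order all_algebra.
From mathcomp Require Import all_classical all_reals all_analysis.
From mathcomp Require Import measurable_realfun ring lra.
Import Order.TTheory GRing.Theory Num.Theory.
Import numFieldNormedType.Exports.
Local Open Scope classical_set_scope.
Local Open Scope ring_scope.
Set Implicit Arguments.
Unset Strict Implicit.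
Unset Printing Implicit Defensive.

(** * Monotone transport on the line *)

Definition mfun_of d d' (T : measurableType d) (U : measurableType d')
    (f : T -> U) (mf : measurable_fun setT f) : {mfun T >-> U} :=
  HB.pack f (isMeasurableFun.Build _ _ _ _ _ mf).

Lemma lower_set_measurable (R : realType) (E : set R) :
  (forall x y, E y -> x <= y -> E x) -> measurable E.
Proof.
move=> lowE; apply: is_interval_measurable => x y Ex Ey z /andP[_ zy].
exact: lowE Ey zy.
Qed.

Lemma upper_set_measurable (R : realType) (E : set R) :
  (forall x y, E x -> x <= y -> E y) -> measurable E.
Proof.
move=> upE; apply: is_interval_measurable => x y Ex Ey z /andP[xz _].
exact: upE Ex xz.
Qed.

(** A lower set with a greatest element is a closed half-line. Without one it is an increasing
    countable union of closed half-lines, and continuity from below transfers the bound. *)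
Lemma measure_lower_set_le (R : realType) (m : {measure set R -> \bar R})
    (E : set R) (t : \bar R) :
  (0 <= t)%E -> (forall x y, E y -> x <= y -> E x) ->
  (forall y, E y -> (m `]-oo, y]%classic <= t)%E) -> (m E <= t)%E.
Proof.
move=> t0 lowE mEt.
have [->|/set0P[y0 Ey0]] := eqVneq E set0; first by rewrite measure0.
have [[y Ey ymax]|nomax] := pselect (exists2 y, E y & forall z, E z -> z <= y).
  rewrite (_ : E = `]-oo, y]%classic); first exact: mEt.
  apply/seteqP; split => z /=; rewrite in_itv/=; first exact: ymax.
  exact: lowE Ey.
(* [s] runs through the rationals of [E], with [y0] as filler, and [M] is its running maximum. The
   half-lines below [M n] exhaust [E] because every element of [E] lies strictly below another one,
   hence below a rational of [E]. *)
pose s n := if @unpickle rat n is Some q then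
  (if ratr q \in E then ratr q else y0) else y0.
have Es n : E (s n).
  by rewrite /s; case: unpickle => // q; case: ifPn => // /set_mem.
pose M := fix M n := if n is n'.+1 then Num.max (M n') (s n) else s 0%N.
have EM n : E (M n).
  elim: n => [|n ih]; first exact: Es.
  by rewrite /= /Num.max; case: ifP.
have sM n : s n <= M n by case: n => [|n] //=; rewrite le_max lexx orbT.
have ndM n : M n <= M n.+1 by rewrite /= le_max lexx.
have EE : E = \bigcup_n `]-oo, M n]%classic.
  apply/seteqP; split => [z Ez|z [n _]]; last first.
    by rewrite /= in_itv/=; exact: lowE.
  have [w Ew zw] : exists2 w, E w & z < w.
    apply/not_exists2P => H; apply: nomax; exists z => // w Ew.
    by rewrite leNgt; apply/negP => zw; have [] := H w.
  have [q] := rat_in_itvoo zw; rewrite in_itv/= => /andP[zq qw].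
  exists (pickle q) => //=; rewrite in_itv/=; apply: le_trans (sM _).
  rewrite /s pickleK ifT; first exact: ltW.
  by apply/mem_set; apply: lowE Ew _; exact: ltW.
have ndS : nondecreasing_seq (fun n => `]-oo, M n]%classic : set R).
  apply/nondecreasing_seqP => n; apply/subsetPset => z /=; rewrite !in_itv/=.
  by move=> /le_trans; apply; exact: ndM.
have mS n : measurable (`]-oo, M n]%classic : set R) by exact: measurable_itv.
rewrite EE; have := nondecreasing_cvg_mu mS (bigcupT_measurable _ mS) ndS.
move=> /(_ _ m) cv; rewrite -(cvg_lim _ cv)//; apply: lime_le.
  by apply/cvg_ex; eexists; exact: cv.
by apply: nearW => n /=; exact: mEt.
Qed.

(** Reflection [x |-> - x] of the lower case. *)
Lemma measure_upper_set_le (R : realType) (m : {measure set R -> \bar R})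
    (E : set R) (t : \bar R) :
  (0 <= t)%E -> (forall x y, E x -> x <= y -> E y) ->
  (forall y, E y -> (m `[y, +oo[%classic <= t)%E) -> (m E <= t)%E.
Proof.
move=> t0 upE mEt; have mN : measurable_fun setT (-%R : R -> R) by [].
have := @measure_lower_set_le R (pushforward m (-%R : R -> R)) (-%R @^-1` E) t t0.
rewrite /pushforward => /(_ mN) H.
have -> : E = -%R @^-1` (-%R @^-1` E) :> set R.
  by apply/seteqP; split=> x /=; rewrite opprK.
apply: H => [x y Ey xy|y Ey]; first by apply: upE Ey _; rewrite lerN2.
suff yE : -%R @^-1` `]-oo, y]%classic = `[- y, +oo[%classic :> set R.
  by have := mEt _ Ey; rewrite -yE.
by apply/seteqP; split => x; rewrite /= !in_itv/= andbT lerNl.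
Qed.

Lemma fine_measureD d (T : measurableType d) (R : realType)
    (m : {finite_measure set T -> \bar R}) (A B : set T) :
  measurable A -> measurable B -> A `<=` B ->
  fine (m (B `\` A)) = fine (m B) - fine (m A).
Proof.
move=> mA mB AB; rewrite measureD//; last by rewrite ltey_eq fin_num_measure.
by rewrite setIidr// fineB// fin_num_measure.
Qed.

Lemma le_fine_measure d (T : measurableType d) (R : realType)
    (m : {finite_measure set T -> \bar R}) (A B : set T) :
  measurable A -> measurable B -> A `<=` B -> fine (m A) <= fine (m B).
Proof.
by move=> mA mB AB; rewrite fine_le ?fin_num_measure// le_measure ?inE.
Qed.

Section monotone_transport.
Context {R : realType}.
Variables a b : {finite_measure set R -> \bar R}.

Let F x := fine (a `]-oo, x]%classic).
Let H x := fine (b `]-oo, x]%classic).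
Let c := fine (a setT).

(** [sup (S y)] is the upper quantile of [b] at the level [F y], so [T] is the quantile transport
    from [a] to [b]. With this choice a pointwise bound [H <= F] puts [y] itself in [S y], whence
    [y <= T y]. *)
Let S y := [set z | H z <= F y].
Let G := [set y | 0 < F y /\ F y < c].
Let T y := if y \in G then sup (S y) else 0.

Let ndcdf (m : {finite_measure set R -> \bar R}) x y : x <= y ->
  fine (m `]-oo, x]%classic) <= fine (m `]-oo, y]%classic).
Proof.
move=> xy; apply: le_fine_measure => // z /=; rewrite !in_itv/= => /le_trans.
exact.
Qed.

Let ndF x y : x <= y -> F x <= F y. Proof. exact: ndcdf. Qed.
Let ndH x y : x <= y -> H x <= H y. Proof. exact: ndcdf. Qed.

Let fine_lower_le (m : {finite_measure set R -> \bar R}) (E : set R) (t : R) :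
  0 <= t -> (forall x y, E y -> x <= y -> E x) ->
  (forall y, E y -> fine (m `]-oo, y]%classic) <= t) -> fine (m E) <= t.
Proof.
move=> t0 lowE Et; have mE := lower_set_measurable lowE.
rewrite -lee_fin fineK ?fin_num_measure//.
apply: measure_lower_set_le => // y Ey.
by have := Et _ Ey; rewrite -lee_fin fineK ?fin_num_measure.
Qed.

Let fine_upper_le (m : {finite_measure set R -> \bar R}) (E : set R) (t : R) :
  0 <= t -> (forall x y, E x -> x <= y -> E y) ->
  (forall y, E y -> fine (m `[y, +oo[%classic) <= t) -> fine (m E) <= t.
Proof.
move=> t0 upE Et; have mE := upper_set_measurable upE.
rewrite -lee_fin fineK ?fin_num_measure//.
apply: measure_upper_set_le => // y Ey.
by have := Et _ Ey; rewrite -lee_fin fineK ?fin_num_measure.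
Qed.

Let fine_oy (m : {finite_measure set R -> \bar R}) x :
  fine (m `]x, +oo[%classic) = fine (m setT) - fine (m `]-oo, x]%classic).
Proof. by rewrite -fine_measureD// setTD setCitvl. Qed.

Let fine_cy (m : {finite_measure set R -> \bar R}) x :
  fine (m `[x, +oo[%classic) = fine (m setT) - fine (m `]-oo, x[%classic).
Proof. by rewrite -fine_measureD// setTD setCitvl. Qed.

Hypothesis ab : a setT = b setT.
Hypothesis a1 : forall x, a [set x] = 0.

Let cb : c = fine (b setT). Proof. by rewrite /c ab. Qed.

Let Fo x : fine (a `]-oo, x[%classic) = F x.
Proof.
rewrite /F -(@setUitv1 _ _ -oo%O x true)// measureU//; last first.
  by apply/seteqP; split => z //= -[] /[swap] ->; rewrite in_itv/= ltxx.
by rewrite [X in (_ + X)%E](_ : _ = 0%E) ?adde0//; exact: a1.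
Qed.

Let aFle t : 0 <= t -> fine (a [set y | F y <= t]) <= t.
Proof.
by move=> t0; apply: fine_lower_le => // x y /= Fy /ndF/le_trans; exact.
Qed.

Let aFge t : t <= c -> fine (a [set y | t <= F y]) <= c - t.
Proof.
move=> tc; apply: fine_upper_le; first by rewrite subr_ge0.
  by move=> x y /= Fx /ndF; exact: le_trans.
by move=> y /= ty; rewrite fine_cy Fo lerB.
Qed.

Let intG : is_interval G.
Proof.
move=> x y [x0 xc] [y0 yc] z /andP[xz zy]; split.
  exact: lt_le_trans x0 (ndF xz).
exact: le_lt_trans (ndF zy) yc.
Qed.

Let mG : measurable G. Proof. exact: is_interval_measurable. Qed.

Let F0 x : 0 <= F x. Proof. exact: fine_ge0. Qed.

Let c0 : 0 <= c. Proof. exact: fine_ge0. Qed.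

Let mFle t : measurable [set y | F y <= t].
Proof. by apply: lower_set_measurable => x y /= Fy /ndF/le_trans; apply. Qed.

Let mFge t : measurable [set y | t <= F y].
Proof. by apply: upper_set_measurable => x y /= Fx /ndF; apply: le_trans. Qed.

Let null_fine (A : set R) : measurable A -> fine (a A) <= 0 -> a A = 0.
Proof.
move=> mA A0; rewrite -(fineK (fin_num_measure a _ mA)).
by congr EFin; apply/eqP; rewrite eq_le A0 fine_ge0.
Qed.

Let aG : a (~` G) = 0.
Proof.
have -> : ~` G = [set y | F y <= 0] `|` [set y | c <= F y].
  apply/seteqP; split => y /=.
    by move/not_andP => -[/negP|/negP]; rewrite -leNgt; [left|right].
  by move=> + [y0 yc] => -[]; rewrite leNgt ?y0 ?yc.
apply/null_set_setU => //; apply: null_fine => //.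
  exact: aFle.
by rewrite (le_trans (aFge _))// subrr.
Qed.

Let S_neq0 y : G y -> S y !=set0.
Proof.
move=> [y0 yc]; apply: contrapT => Sy.
have : fine (b setT) <= c - F y.
  apply: fine_upper_le => //; first by rewrite subr_ge0 ltW.
  move=> z _; rewrite fine_cy -cb lerB//.
  apply: (@le_trans _ _ (H (z - 1))).
    by rewrite leNgt; apply/negP => zy; apply: Sy; exists (z - 1); exact: ltW.
  apply: le_fine_measure => // w /=; rewrite !in_itv/= => /le_lt_trans; apply.
  by rewrite ltrBlDr ltrDl.
by rewrite -cb; lra.
Qed.

Let S_ub y : G y -> has_ubound (S y).
Proof.
move=> [y0 yc]; apply: contrapT => Sy.
have : fine (b setT) <= F y.
  apply: fine_lower_le => // z _; rewrite leNgt; apply/negP => yz.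
  apply: Sy; exists z => w /= wy; rewrite leNgt; apply/negP => zw.
  by have := ndH (ltW zw); rewrite -/(H z) in yz; rewrite /S /= in wy; lra.
by rewrite -cb; lra.
Qed.

(** With [T_gt], the Galois connection between quantile and distribution function. The levels with
    [F y = H x] need no finer analysis, because [aFle] and [aFge] bound closed level sets. *)
Let T_le y x : G y -> F y < H x -> T y <= x.
Proof.
move=> Gy yx; rewrite /T mem_set//; apply: ge_sup; first exact: S_neq0.
move=> z /= zy; rewrite leNgt; apply/negP => /ltW /ndH; rewrite /S /= in zy.
by lra.
Qed.

Let T_gt y x : G y -> T y <= x -> F y <= H x.
Proof.
move=> Gy; rewrite /T mem_set// => Tyx; have [y0 yc] := Gy.
suff : fine (b `]x, +oo[%classic) <= c - F y by rewrite fine_oy -cb /H; lra.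
apply: fine_upper_le; first by rewrite subr_ge0 ltW.
  move=> u v /=; rewrite !in_itv/= !andbT; exact: lt_le_trans.
move=> z /=; rewrite in_itv/= andbT => xz; rewrite fine_cy -cb lerB//.
(* A point strictly between [x] and [z] exceeds [sup (S y)], hence has [F y < H w]. Passing from all
   [z > x] to [x] is the right continuity of [H], here supplied by [fine_upper_le]. *)
pose w := (x + z) / 2; have [xw wz] : x < w /\ w < z by rewrite /w; split; lra.
apply: (@le_trans _ _ (H w)).
  rewrite leNgt; apply/negP => wy; have : w <= sup (S y).
    by apply: ub_le_sup; [exact: S_ub|exact: ltW].
  by lra.
by apply: le_fine_measure => // u /=; rewrite !in_itv/= => /le_lt_trans; exact.
Qed.

Let ndT : {in G &, {homo T : x y / x <= y}}.
Proof.
move=> x y /set_mem Gx /set_mem Gy xy; rewrite /T !mem_set//.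
apply: ge_sup; first exact: S_neq0.
move=> z /= zx; apply: ub_le_sup; first exact: S_ub.
exact: le_trans zx (ndF xy).
Qed.

Let mT : measurable_fun setT T.
Proof.
apply: (measurable_fun_if measurableT) => //.
- apply: (measurable_fun_bool true).
  rewrite setTI (_ : _ @^-1` _ = G)//.
  by apply/seteqP; split => y /= => [/set_mem|/mem_set].
- rewrite setTI (_ : _ @^-1` _ = G); last first.
    by apply/seteqP; split => y /= => [/set_mem|/mem_set].
  apply: (measurability (@RGenCInfty.G R)) => [|/= _ [_] [r] -> <-].
    exact: RGenCInfty.measurableE.
  apply: is_interval_measurable => s t/=.
  rewrite !in_itv/= !andbT => -[Gs rs] [Gt rt] u /andP[su ut].
  have Gu : G u by apply: (intG Gs Gt); rewrite su.
  split => //; rewrite in_itv/= andbT (le_trans rs)//.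
  by have := ndT (mem_set Gs) (mem_set Gu) su; rewrite /T !mem_set.
Qed.

Let aIG (A : set R) : measurable A -> a A = a (A `&` G).
Proof.
move=> mA; rewrite (measureDI a mA mG) [X in (X + _)%E](_ : _ = 0) ?add0e//.
apply: (subset_measure0 _ _ _ aG); last by move=> x [].
- exact: measurableD.
- exact: measurableC.
Qed.

(** Up to a null set, [T y > x] forces [H x <= F y], and [T y <= x] forces [F y <= H x]. The two
    tail bounds then squeeze the mass, as [a] and [b] have the same total. *)
Let transport_oy x : a (T @^-1` `]x, +oo[%classic) = b `]x, +oo[%classic.
Proof.
have mTi (i : interval R) : measurable (T @^-1` [set` i]).
  by have := mT measurableT (measurable_itv i); rewrite setTI.
suff : fine (a (T @^-1` `]x, +oo[%classic)) = fine (b `]x, +oo[%classic).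
  move=> abx; rewrite -[LHS]fineK; last exact: fin_num_measure.
  by rewrite abx fineK//; exact: fin_num_measure.
have Hc : H x <= c by rewrite cb; exact: le_fine_measure.
have H0 : 0 <= H x by exact: fine_ge0.
rewrite fine_oy -cb -/(H x); apply/eqP; rewrite eq_le; apply/andP; split.
  apply: le_trans (aFge Hc); rewrite (aIG (mTi _)).
  apply: le_fine_measure => //; first exact: measurableI.
  move=> y [/=]; rewrite in_itv/= andbT => xT Gy; rewrite leNgt; apply/negP.
  by move=> /(T_le Gy); rewrite leNgt xT.
have -> : T @^-1` `]x, +oo[ = setT `\` T @^-1` `]-oo, x].
  by rewrite setTD preimage_setC setCitvl.
rewrite fine_measureD// -/c lerB// (aIG (mTi _)).
apply: le_trans (aFle H0); apply: le_fine_measure => //; first exact: measurableI.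
by move=> y [/=]; rewrite in_itv/= => Tx Gy; exact: T_gt.
Qed.

Let transportE B : measurable B -> a (T @^-1` B) = b B.
Proof.
move=> mB.
have := @measure_unique _ R R (@RGenOInfty.G R)
  (fun n => `]- n%:R, +oo[%classic) _ _ _ _ (pushforward a T) b _ _ B mB.
rewrite /pushforward /=; apply.
- exact: RGenOInfty.measurableE.
- move=> _ _ [x ->] [y ->]; exists (Num.max x y).
  apply/seteqP; split => z /=; rewrite !in_itv/= !andbT gt_max.
    by case=> -> ->.
  by move/andP.
- by move=> n; exists (- n%:R).
- apply/seteqP; split => // x _; exists (Num.truncn `|x|).+1 => //=.
  rewrite in_itv/= andbT ltrNl; have := truncnS_gt `|x|.
  by apply: le_lt_trans; rewrite -normrN ler_norm.
- exact: mT.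
- by move=> _ [x ->]; exact: transport_oy.
- move=> k; rewrite ltey_eq fin_num_measure//.
  by have := mT measurableT (measurable_itv `]- k%:R, +oo[); rewrite setTI.
Qed.

(* Monotonicity can only hold off a null set: the quantile function of [b] may
   be infinite at the levels [0] and [b setT], where [sup] is a junk value. *)
Lemma monotone_transport : exists (f : {mfun R >-> R}) (D : set R),
  [/\ measurable D, is_interval D, a (~` D) = 0,
      {in D &, {homo f : x y / x <= y}} &
      (forall B, measurable B -> a (f @^-1` B) = b B) /\
      ((forall y, b `]-oo, y]%classic <= a `]-oo, y]%classic)%E ->
       forall y, D y -> y <= f y)].
Proof.
exists (mfun_of mT), G; split => //; split => //= ba y Gy.
rewrite /T mem_set//; apply: ub_le_sup; first exact: S_ub.
by rewrite /S /= fine_le ?fin_num_measure.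
Qed.

End monotone_transport.

(** * From a martingale coupling to the convex order *)

Lemma convex_fun_chord (R : realType) (h : R -> R) (y x z : R) :
  convex_fun h -> y < x -> x < z ->
  (h x - h y) / (x - y) <= (h z - h x) / (z - x).
Proof.
move=> ch yx xz; pose t := (z - x) / (z - y).
have t0 : 0 <= t by rewrite divr_ge0// subr_ge0 ltW// (lt_trans yx).
have t1 : t <= 1 by rewrite ler_pdivrMr ?subr_gt0 ?(lt_trans yx)//; lra.
have := ch y z t t0 t1.
have -> : t * y + (1 - t) * z = x by rewrite /t; field; lra.
rewrite -subr_ge0 => hx.
rewrite ler_pdivrMr ?subr_gt0// mulrAC ler_pdivlMr ?subr_gt0//.
have : 0 <= (t * h y + (1 - t) * h z - h x) * (z - y).
  by rewrite mulr_ge0// subr_ge0 ltW// (lt_trans yx).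
rewrite (_ : _ * _ = (z - x) * h y + (x - y) * h z - h x * (z - y)); first lra.
by rewrite /t; field; lra.
Qed.

(** The subgradient is the left derivative, the supremum of the chord slopes on the left, which
    every chord slope on the right bounds. *)
Lemma convex_fun_subgradient (R : realType) (h : R -> R) :
  convex_fun h -> exists g : R -> R, forall x y, h x + g x * (y - x) <= h y.
Proof.
move=> ch; pose S x := [set (h x - h y) / (x - y) | y in [set y | y < x]].
have Sub x z : x < z -> ubound (S x) ((h z - h x) / (z - x)).
  by move=> xz _ [y /= yx <-]; exact: convex_fun_chord.
have Sne x : S x !=set0.
  by exists ((h x - h (x - 1)) / (x - (x - 1))), (x - 1) => //=; lra.
exists (fun x => sup (S x)) => x y; have [xy|yx|->] := ltgtP x y.
- have : sup (S x) <= (h y - h x) / (y - x) by apply: ge_sup => //; exact: Sub.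
  by rewrite ler_pdivlMr ?subr_gt0//; lra.
- have : (h x - h y) / (x - y) <= sup (S x).
    apply: ub_le_sup; last by exists y.
    by exists ((h (x + 1) - h x) / (x + 1 - x)); apply: Sub; lra.
  by rewrite ler_pdivrMr ?subr_gt0//; lra.
- by rewrite subrr mulr0 addr0.
Qed.

Lemma integrable_distribution d (T : measurableType d) (R : realType)
    (P : probability T R) (X : {mfun T >-> R}) (m : probability R R)
    (h : R -> R) :
  same_measure (distribution P X) m -> m.-integrable setT (EFin \o h) ->
  P.-integrable setT (EFin \o (h \o X)) /\
  (\int[P]_w (h (X w))%:E = \int[m]_x (h x)%:E)%E.
Proof.
move=> Xm /integrableP[mh hoo].
have mE (f : R -> \bar R) :
    (\int[distribution P X]_x f x = \int[m]_x f x)%E.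
  by apply: eq_measure_integral => A mA _; exact: Xm.
have mhX : measurable_fun setT (EFin \o (h \o X)).
  exact: (measurableT_comp mh).
have ihX : P.-integrable setT (EFin \o (h \o X)).
  apply/integrableP; split=> //.
  rewrite -mE in hoo; apply: le_lt_trans hoo.
  by rewrite (@ge0_integral_distribution _ _ _ _ _ P X)//; exact: measurableT_comp.
split => //; rewrite -mE.
by rewrite (@integral_distribution _ _ _ _ _ P X).
Qed.

Lemma cond_exp_convex_le d (T : measurableType d) (R : realType)
    (P : probability T R) (X Y : {mfun T >-> R}) (h : R -> R) :
  convex_fun h -> measurable_fun setT h -> cond_exp_is_X P X Y ->
  P.-integrable setT (EFin \o (h \o X)) ->
  P.-integrable setT (EFin \o (h \o Y)) ->
  (\int[P]_w (h (X w))%:E <= \int[P]_w (h (Y w))%:E)%E.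
Proof.
move=> ch mh [iX [iY XY]] ihX ihY.
have [g gP] := convex_fun_subgradient ch.
apply/lee_addgt0Pr => e e0.
pose q n : R := if @unpickle rat n is Some r then ratr r else 0.
pose B n := [set x | h x - e <= h (q n) + g (q n) * (x - q n)].
have mB n : measurable (B n).
  rewrite -[B n]setTI; apply: measurable_fun_ler => //.
    exact: measurable_funB.
  apply: measurable_funD => //; apply: measurable_funM => //.
  exact: measurable_funB.
have BT : \bigcup_n B n = setT.
  apply/seteqP; split => // x _.
  have g1 : 0 <= g (x + 1) - g x.
    have := gP x (x + 1); have := gP (x + 1) x; lra.
  (* [k] bounds the growth of the subgradient on [[x, x + 1]], the added 1 making it positive. The
     tangent at a rational within [min 1 (e / k)] to the right of [x] then falls short of [h x] by
     at most [e]. *)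
  pose k := g (x + 1) - g x + 1; have k0 : 0 < k by rewrite /k; lra.
  have xd : x < x + Num.min 1 (e / k) by rewrite ltrDl lt_min ltr01 divr_gt0.
  have [r] := rat_in_itvoo xd; rewrite in_itv/= => /andP[xr rd].
  exists (pickle r) => //; rewrite /B /= /q pickleK; set z := ratr r in xr rd *.
  have zx1 : z < x + 1.
    by apply: (lt_le_trans rd); rewrite lerD2l ge_min lexx.
  have zxe : (z - x) * k <= e.
    rewrite -ler_pdivlMr// lerBlDl; apply: (le_trans (ltW rd)).
    by rewrite lerD2l ge_min lexx orbT.
  have gz : g z <= g (x + 1).
    have H1 := gP z (x + 1); have H2 := gP (x + 1) z.
    have : 0 <= (g (x + 1) - g z) * (x + 1 - z) by lra.
    by rewrite pmulr_lge0; lra.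
  have Hx := gP x z.
  have : (g z - g x) * (z - x) <= k * (z - x).
    by rewrite ler_pM2r ?subr_gt0// /k; lra.
  by rewrite (mulrC (z - x)) in zxe; lra.
(* [A n] collects the points whose first good tangent is the [n]-th one. *)
pose A := seqDU B.
have mA n : measurable (A n) by apply: measurableD => //; exact: bigsetU_measurable.
pose D w := h (Y w) - h (X w) + e.
have iD : P.-integrable setT (EFin \o D).
  rewrite (_ : EFin \o D = ((EFin \o (h \o Y)) \- (EFin \o (h \o X))) \+ cst e%:E)%E//.
  apply: integrableD => //; first exact: integrableB.
  exact: finite_measure_integrable_cst.
have mXA n : measurable (X @^-1` A n) by rewrite -[_ @^-1` _]setTI; exact: measurable_funP.
have XAT : \bigcup_n (X @^-1` A n) = setT.
  by rewrite -preimage_bigcup /A -seqDU_bigcup_eq BT preimage_setT.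
have D0 : (0 <= \int[P]_w (D w)%:E)%E.
  rewrite -XAT integral_bigcup//; first last.
  - by rewrite XAT.
  - apply/trivIsetP => i j _ _ ij; rewrite -preimage_setI.
    by have /trivIsetP -> := @trivIset_seqDU _ B; rewrite ?preimage_set0.
  apply: nneseries_ge0 => n _ _.
  have iS f : P.-integrable setT f -> P.-integrable (X @^-1` A n) f.
    by apply: integrableS.
  (* By the choice of [B n], the integrand [D] is at least [g (q n) * (Y - X)] on this event. The
     slope is constant there, so the property defining [E(Y | X) = X] makes this lower bound
     integrate to 0. *)
  have -> : 0%E = (\int[P]_(w in X @^-1` A n)
      ((g (q n))%:E * ((Y w)%:E - (X w)%:E)))%E.
    rewrite integralZl//; last by apply: integrableB => //; exact: iS.
    rewrite integralB//; [|exact: iS..].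
    by rewrite XY// subee ?mule0//; exact: (integrable_fin_num _ (iS _ iX)).
  apply: le_integral => //.
  - apply: integrableZl => //; apply: integrableB => //; exact: iS.
  - exact: iS.
  - move=> w; rewrite inE /= => -[Bw _].
    rewrite lee_fin /D; have := gP (q n) (Y w); rewrite /B /= in Bw.
    by lra.
have fX := integrable_fin_num measurableT ihX.
have fY := integrable_fin_num measurableT ihY.
have DE : (\int[P]_w (D w)%:E =
    \int[P]_w (h (Y w))%:E - \int[P]_w (h (X w))%:E + e%:E)%E.
  rewrite -integralB// -[X in (_ + X)%E]mule1 -(@probability_setT _ _ _ P).
  rewrite -integral_cst// -integralD//; first exact: integrableB.
  exact: finite_measure_integrable_cst.
move: D0; rewrite DE; rewrite /comp /= in fX fY.
rewrite -(fineK fX) -(fineK fY) -EFinB -EFinD -EFinD !lee_fin; lra.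
Qed.

Lemma coupling_convex_order d (T : measurableType d) (R : realType)
    (P : probability T R) (X Y : {mfun T >-> R}) (mu nu : probability R R) :
  same_measure (distribution P X) mu -> same_measure (distribution P Y) nu ->
  cond_exp_is_X P X Y -> convex_order mu nu.
Proof.
move=> Xmu Ynu XY h ch imu inu.
have [ihX <-] := integrable_distribution Xmu imu.
have [ihY <-] := integrable_distribution Ynu inu.
apply: cond_exp_convex_le => //.
by have /integrableP[/measurable_EFinP] := imu.
Qed.

(** * Decomposition of the convex-order pair *)

Section finite_measure_of.
Context d (T : measurableType d) (R : realType).
Variable m : {measure set T -> \bar R}.
Hypothesis moo : (m setT < +oo)%E.

Let fm : set T -> \bar R := m.

Let fm_fin : fin_num_fun fm. Proof. exact: lty_fin_num_fun. Qed.

HB.instance Definition _ := Measure.on fm.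
HB.instance Definition _ := @Measure_isFinite.Build _ _ _ fm fm_fin.

Lemma finite_measure_of :
  exists m' : {finite_measure set T -> \bar R}, forall A, m' A = m A.
Proof. by exists fm. Qed.

End finite_measure_of.

Section density.
Context d (T : measurableType d) (R : realType).
Variables (m : {measure set T -> \bar R}) (f : T -> \bar R).
Hypotheses (f0 : forall x, (0 <= f x)%E) (mf : measurable_fun setT f).

Let dens (A : set T) := (\int[m]_(x in A) f x)%E.

Let dens0 : dens set0 = 0%E. Proof. exact: integral_set0. Qed.

Let dens_ge0 A : (0 <= dens A)%E. Proof. exact: integral_ge0. Qed.

Let dens_sigma : semi_sigma_additive dens.
Proof.
move=> F mF tF mUF; rewrite /dens ge0_integral_bigcup//.
  by apply: is_cvg_ereal_nneg_natsum => n _; exact: dens_ge0.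
exact: measurable_funTS.
Qed.

HB.instance Definition _ := isMeasure.Build _ _ _ dens dens0 dens_ge0 dens_sigma.

Lemma density_measure : exists n : {measure set T -> \bar R},
  forall A, n A = (\int[m]_(x in A) f x)%E.
Proof. by exists dens. Qed.

End density.

(** The Radon-Nikodym derivative of the new measure has the same integrals as [f] over all
    measurable sets, so it equals [f] almost everywhere; the change of variables for the derivative
    then passes to [f]. *)
Lemma finite_density_measure d (T : measurableType d) (R : realType)
    (m : {finite_measure set T -> \bar R}) (f : T -> \bar R) :
  (forall x, 0 <= f x)%E -> measurable_fun setT f -> (\int[m]_x f x < +oo)%E ->
  exists n : {finite_measure set T -> \bar R},
    (forall A, n A = \int[m]_(x in A) f x)%E /\
    forall g, (forall x, 0 <= g x)%E -> measurable_fun setT g ->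
      forall A, measurable A ->
      (\int[n]_(x in A) g x = \int[m]_(x in A) (g x * f x))%E.
Proof.
move=> f0 mf foo; have [n0 n0E] := density_measure m f0 mf.
have [n nE] : exists n : {finite_measure set T -> \bar R}, forall A, n A = n0 A.
  by apply: finite_measure_of; rewrite n0E.
have {n0 n0E}nE A : (n A = \int[m]_(x in A) f x)%E by rewrite nE n0E.
exists n; split => // g g0 mg A mA.
have nm : n `<< m.
  apply/null_content_dominatesP => B mB mB0; rewrite nE.
  apply: null_set_integral => //.
  exact: measurable_funTS.
have fi : m.-integrable setT f.
  apply/integrableP; split => //.
  by under eq_integral do rewrite gee0_abs//.
pose k := Radon_Nikodym_SigmaFinite.f n m.
have ik : m.-integrable setT k := Radon_Nikodym_SigmaFinite.f_integrable nm.
have mk : measurable_fun setT k := measurable_int _ ik.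
have k0 : forall x, (0 <= k x)%E := Radon_Nikodym_SigmaFinite.f_ge0 nm.
have fk : ae_eq m setT f k.
  apply: integral_ae_eq => // E _ mE.
  by rewrite -nE (Radon_Nikodym_SigmaFinite.f_integral nm).
rewrite -(Radon_Nikodym_SigmaFinite.change_of_variables nm g0 mA); last first.
  exact: measurable_funTS.
apply: ge0_ae_eq_integral => //.
- by apply: measurable_funTS; exact: emeasurable_funM.
- by apply: measurable_funTS; exact: emeasurable_funM.
- by move=> x _; rewrite mule_ge0.
- by move=> x _; rewrite mule_ge0.
- apply: ae_eqe_mul2l; apply: ae_eq_sym; apply: ae_eq_subset fk; exact: subsetT.
Qed.

(** The new measure is the image under [s] of [m] restricted to [C] with weight [k \o s]. Taking [s]
    the identity, then the transport [S], with the same [C], produces two measures that share the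
    mass of one piece. *)
Lemma weighted_image_measure (R : realType)
    (m : {finite_measure set R -> \bar R}) (C : set R) (s : {mfun R >-> R})
    (k : R -> \bar R) : measurable C ->
  (forall x, 0 <= k x)%E -> measurable_fun setT k ->
  (\int[m]_y k (s y) < +oo)%E ->
  exists n : {finite_measure set R -> \bar R},
    (forall A, measurable A -> n A = \int[m]_(y in C `&` s @^-1` A) k (s y))%E /\
    forall g, (forall x, 0 <= g x)%E -> measurable_fun setT g ->
      (\int[n]_x g x = \int[m]_(y in C) (g (s y) * k (s y)))%E.
Proof.
move=> mC k0 mk koo.
have ms : measurable_fun setT s by [].
have mks : measurable_fun setT (k \o s) by exact: measurableT_comp.
have mpre A : measurable A -> measurable (s @^-1` A).
  by move=> mA; rewrite -[_ @^-1` _]setTI; exact: measurable_funP.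
pose f := (k \o s) \_ C.
have f0 x : (0 <= f x)%E by rewrite /f patchE; case: ifP => //= _; exact: k0.
have mf : measurable_fun setT f.
  by apply/(measurable_restrictT _ mC); exact: measurable_funTS.
have foo : (\int[m]_x f x < +oo)%E.
  apply: le_lt_trans koo; apply: ge0_le_integral => // x _.
  by rewrite /f patchE; case: ifP => //= _; exact: k0.
have [n0 [n0E n0I]] := finite_density_measure f0 mf foo.
have [n nE] : exists n : {finite_measure set R -> \bar R},
    forall A, n A = pushforward n0 s A.
  apply: finite_measure_of.
  have : (n0 setT < +oo)%E by rewrite ltey_eq fin_num_measure.
  exact.
exists n; split => [A mA|g g0 mg].
  by rewrite nE /pushforward n0E -integral_mkcondr setIC.
transitivity (\int[pushforward n0 s]_x g x)%E.
  by apply: eq_measure_integral => B mB _; exact: nE.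
rewrite ge0_integral_pushforward// preimage_setT n0I//; last 2 first.
- by move=> x /=.
- exact: measurableT_comp.
rewrite [RHS]integral_mkcond; apply: eq_integral => x _; rewrite /f !patchE /=.
by case: ifP => // _; rewrite mule0.
Qed.

Lemma measurable_ltr_set (R : realType) (f g : R -> R) :
  measurable_fun setT f -> measurable_fun setT g ->
  measurable [set y | f y < g y].
Proof.
by move=> mf mg; rewrite -[X in measurable X]setTI; exact: measurable_fun_ltr.
Qed.

Lemma measurable_ltr_set3 (R : realType) (G : set R)
    (f1 f2 g1 g2 h1 h2 : R -> R) : measurable G -> measurable_fun setT f1 ->
  measurable_fun setT f2 -> measurable_fun setT g1 -> measurable_fun setT g2 ->
  measurable_fun setT h1 -> measurable_fun setT h2 ->
  measurable [set y | G y /\ [/\ f1 y < f2 y, g1 y < g2 y & h1 y < h2 y]].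
Proof.
move=> *; rewrite (_ : mkset _ = G `&` [set y | f1 y < f2 y] `&`
    [set y | g1 y < g2 y] `&` [set y | h1 y < h2 y]).
  by do 3 (apply: measurableI; last by apply: measurable_ltr_set).
by apply/seteqP; split => y /=; [case=> ? []|case=> [[[]]]].
Qed.

Section matched_decomposition.
Context {R : realType} (mu nu : probability R R).
Variables (T : {mfun R >-> R}) (G : set R).
Hypothesis mu_int : mu.-integrable setT (EFin \o (fun x : R => x)).
Hypothesis nu_int : nu.-integrable setT (EFin \o (fun x : R => x)).
Hypothesis nu1 : forall x, nu [set x] = 0%E.
Hypothesis cx : convex_order mu nu.
Hypothesis mG : measurable G.
Hypothesis nuG : nu (~` G) = 0%E.
Hypothesis ndT : {in G &, {homo T : x y / x <= y}}.
Hypothesis Tmu : forall B, measurable B -> nu (T @^-1` B) = mu B.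

Let u y : R := T y - y.
Let up y : R := Num.max (u y) 0.
Let um y : R := Num.max (- u y) 0.
(* [1 / u^+] and [1 / u^-], with value [0] where the denominator vanishes. *)
Let kp y : R := powR (up y) (-1).
Let km y : R := powR (um y) (-1).

Let mT : measurable_fun setT T. Proof. by []. Qed.
Let mu_ : measurable_fun setT u. Proof. exact: measurable_funB. Qed.
Let mup : measurable_fun setT up. Proof. exact: measurable_maxr. Qed.
Let mum : measurable_fun setT um.
Proof. by apply: measurable_maxr => //; exact: measurable_funN. Qed.
Let mkp : measurable_fun setT kp.
Proof. exact: (measurableT_comp (measurable_powR _)). Qed.
Let mkm : measurable_fun setT km.
Proof. exact: (measurableT_comp (measurable_powR _)). Qed.

Let up0 y : 0 <= up y. Proof. by rewrite le_max lexx orbT. Qed.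
Let um0 y : 0 <= um y. Proof. by rewrite le_max lexx orbT. Qed.
Let kp0 y : 0 <= kp y. Proof. exact: powR_ge0. Qed.
Let km0 y : 0 <= km y. Proof. exact: powR_ge0. Qed.

Let powRN1M (x : R) : 0 <= x -> powR x (-1) * x = (0 < x)%R%:R.
Proof.
rewrite le_eqVlt => /predU1P[<-|x0]; first by rewrite ltxx mulr0.
by rewrite x0 powR_inv1 ?ltW// mulVf// gt_eqF.
Qed.

Let kpM y : kp y * up y = (0 < u y)%R%:R.
Proof. by rewrite powRN1M// lt_max ltxx orbF. Qed.
Let kmM y : km y * um y = (u y < 0)%R%:R.
Proof. by rewrite powRN1M// lt_max ltxx orbF oppr_gt0. Qed.

Let sameT : same_measure (distribution nu T) mu.
Proof. by move=> A mA; exact: Tmu. Qed.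

Let iT : nu.-integrable setT (EFin \o T).
Proof. by have [] := integrable_distribution sameT mu_int. Qed.

Let iu : nu.-integrable setT (EFin \o u).
Proof.
rewrite (_ : EFin \o u = (EFin \o T) \- (EFin \o (fun x : R => x)))%E//.
exact: integrableB.
Qed.

Let iup : nu.-integrable setT (EFin \o up).
Proof.
apply: (le_integrable _ _ _ iu) => //; first exact/measurable_EFinP.
move=> y _ /=; rewrite lee_fin ger0_norm// /up ge_max normr_ge0 andbT.
exact: ler_norm.
Qed.

Let ium : nu.-integrable setT (EFin \o um).
Proof.
apply: (le_integrable _ _ _ iu) => //; first exact/measurable_EFinP.
move=> y _ /=; rewrite lee_fin ger0_norm// /um ge_max normr_ge0 andbT.
by rewrite -normrN ler_norm.
Qed.

Let int_fin (f : R -> R) A : measurable A -> nu.-integrable setT (EFin \o f) ->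
  (\int[nu]_(y in A) (f y)%:E)%E \is a fin_num.
Proof.
move=> mA fi; apply: (@integrable_fin_num _ _ _ nu _ mA (EFin \o f)).
by apply: integrableS fi.
Qed.

Let le_int (f g w : R -> R) A : measurable A ->
  nu.-integrable setT (EFin \o f) -> nu.-integrable setT (EFin \o g) ->
  (forall y, A y -> w y = f y - g y) -> (0 <= \int[nu]_(y in A) (w y)%:E)%E ->
  (\int[nu]_(y in A) (g y)%:E <= \int[nu]_(y in A) (f y)%:E)%E.
Proof.
move=> mA fi gi wE w0; rewrite -suber_ge0; last exact: int_fin.
rewrite -integralB//; first last.
- by apply: (@integrableS _ _ _ _ setT _ (EFin \o g)).
- by apply: (@integrableS _ _ _ _ setT _ (EFin \o f)).
suff <- : (\int[nu]_(y in A) (w y)%:E =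
  \int[nu]_(y in A) ((f y)%:E - (g y)%:E))%E by [].
by apply: eq_integral => y /set_mem Ay; rewrite wE.
Qed.

Let cx_int h : convex_fun h -> mu.-integrable setT (EFin \o h) ->
  nu.-integrable setT (EFin \o h) ->
  (0 <= \int[nu]_y (h y - h (T y))%:E)%E.
Proof.
move=> ch imu inu; have [ihT hT] := integrable_distribution sameT imu.
rewrite integralB_EFin// sube_ge0; first by rewrite hT; exact: cx.
by apply/orP; left; exact: int_fin.
Qed.

Let upBum y : up y - um y = u y.
Proof. by rewrite /up /um /Num.max; case: ifPn; case: ifPn; lra. Qed.

(** The identity and its opposite are both convex, so [mu] and [nu] have the same mean; as [T]
    carries [nu] to [mu], this says that [u] has integral 0. *)
Let mean_eq : (\int[nu]_y (up y)%:E = \int[nu]_y (um y)%:E)%E.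
Proof.
apply/eqP; rewrite eq_le; apply/andP; split.
- apply: (@le_int _ _ (fun y => y - T y)) => // [y _|].
    by have := upBum y; rewrite /u; lra.
  by apply: (@cx_int id) => // x y t _ _.
- apply: (@le_int _ _ (fun y => - y - - T y)) => // [y _|].
    by have := upBum y; rewrite /u; lra.
  apply: (@cx_int -%R).
  + by move=> x y t _ _; lra.
  + rewrite (_ : EFin \o -%R = -%E \o (EFin \o (fun x : R => x)))//.
    exact: integrableN.
  + rewrite (_ : EFin \o -%R = -%E \o (EFin \o (fun x : R => x)))//.
    exact: integrableN.
Qed.

Let int_call (m : probability R R) (k : R) :
  m.-integrable setT (EFin \o (fun x : R => x)) ->
  m.-integrable setT (EFin \o (fun x : R => Num.max (k - x) 0)).
Proof.
move=> mi; have ik : m.-integrable setT (EFin \o (fun x : R => k - x)).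
  rewrite (_ : EFin \o _ = cst k%:E \- (EFin \o (fun x : R => x)))%E//.
  apply: integrableB => //.
  have := @finite_measure_integrable_cst _ _ _ m setT k measurableT.
  by [].
apply: (le_integrable _ _ _ ik) => //.
  apply/measurable_EFinP; apply: measurable_maxr => //.
  exact: measurable_funB.
move=> y _ /=; rewrite lee_fin ger0_norm ?le_max ?lexx ?orbT//.
by rewrite ge_max normr_ge0 andbT ler_norm.
Qed.

(** With [h x = max (k - x) 0], one has [h y - h (T y) <= T y - y] for [y <= k] and
    [h y - h (T y) <= 0] for [y > k]. The convex order makes the integral of the left side
    nonnegative, hence that of [u] over the half-line. *)
Let lower_le k : (\int[nu]_(w in `]-oo, k]) (um w)%:E <=
                  \int[nu]_(w in `]-oo, k]) (up w)%:E)%E.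
Proof.
apply: (@le_int _ _ u) => //.
pose h (x : R) := Num.max (k - x) 0.
have ch : convex_fun h.
  move=> x y t t0 t1; have t1' : 0 <= 1 - t by lra.
  have hge z : k - z <= h z /\ 0 <= h z by rewrite /h !le_max !lexx orbT.
  have [[hx hx0] [hy hy0]] := (hge x, hge y).
  rewrite {1}/h ge_max; apply/andP; split; last by rewrite addr_ge0// mulr_ge0.
  have := lerD (ler_wpM2l t0 hx) (ler_wpM2l t1' hy); lra.
have ihT := (integrable_distribution sameT (int_call k mu_int)).1.
apply: (le_trans (cx_int ch (int_call k mu_int) (int_call k nu_int))).
rewrite [leRHS]integral_mkcond; apply: le_integral => //.
- rewrite (_ : (fun y => _) = (EFin \o h) \- (EFin \o (h \o T)))%E//.
  by apply: integrableB => //; exact: int_call.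
- apply/(integrable_mkcond _ _).1 => //; exact: (integrableS _ _ _ iu).
- move=> y _; rewrite patchE; case: ifPn => [/set_mem|/negP yk] /=.
    rewrite in_itv/= lee_fin /u => yk; have : k - T y <= h (T y).
      by rewrite /h le_max lexx.
    have : h y = k - y by apply/max_idPl; rewrite subr_ge0.
    by rewrite /h; lra.
  have {}yk : k < y by rewrite ltNge; apply/negP => ky; apply: yk; rewrite inE.
  have : h y = 0 by apply/max_idPr; rewrite subr_le0 ltW.
  have : 0 <= h (T y) by rewrite /h le_max lexx orbT.
  by rewrite /h lee_fin; lra.
Qed.

(** Let [lp] and [lm] have densities [u^+] and [u^-], and let [S] transport [lp] to [lm]. On each
    piece [C n] of [lp], [al n] divides out [u^+] in place, and [be n] moves the piece by [S] before
    dividing out [u^-]. Summing over the pieces returns [nu] where [T y > y] and where [T y < y],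
    while both balance integrals equal [lp (C n)]. *)
Lemma matched_decomposition :
  exists (q r : nat -> R) (al be : nat -> {finite_measure set R -> \bar R}),
  [/\ forall A, measurable A ->
        (nu A = nu (A `&` [set y | T y = y]) +
                \sum_(0 <= n <oo) (al n A + be n A))%E,
      forall n, al n (~` [set y | G y /\ [/\ y < q n, q n < T y & T y < r n]]) = 0%E,
      forall n, be n (~` [set y | G y /\ [/\ r n < y, q n < T y & T y < r n]]) = 0%E &
      forall n, (\int[al n]_y (Num.max (T y - y) 0)%:E =
                 \int[be n]_y (Num.max (y - T y) 0)%:E)%E].
Proof.
have foo (f : R -> R) : (forall y, 0 <= f y) -> nu.-integrable setT (EFin \o f) ->
    (\int[nu]_y (f y)%:E < +oo)%E.
  by move=> f0 fi; rewrite ltey_eq int_fin.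
have mE (f : R -> R) : measurable_fun setT f -> measurable_fun setT (EFin \o f).
  by move=> mf; exact/measurable_EFinP.
have [lp [lpE lpI]] := @finite_density_measure _ _ _ nu (EFin \o up)
  (fun y => up0 y) (mE _ mup) (foo _ up0 iup).
have [lm [lmE lmI]] := @finite_density_measure _ _ _ nu (EFin \o um)
  (fun y => um0 y) (mE _ mum) (foo _ um0 ium).
have lpm : lp setT = lm setT by rewrite lpE lmE.
have dom (l : {finite_measure set R -> \bar R}) f A :
    (forall A, l A = \int[nu]_(x in A) (f x)%:E)%E -> measurable_fun setT f ->
    measurable A -> nu A = 0%E -> l A = 0%E.
  move=> lE mf mA A0; rewrite lE; apply: null_set_integral => //.
  by apply: measurable_funTS; exact/measurable_EFinP.
have lp1 x : lp [set x] = 0%E by apply: dom lpE _ _ _.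
have [S [GS [mGS _ lpGS _ [SE Sge]]]] := monotone_transport lpm lp1.
have {}Sge y : GS y -> y <= S y.
  by apply: Sge => {}y; rewrite lpE lmE; exact: lower_le.
pose q n : R := if @unpickle (rat * rat)%type n is Some x then ratr x.1 else 0.
pose r n : R := if @unpickle (rat * rat)%type n is Some x then ratr x.2 else 0.
(* The rationals separate [y < q n < T y] and [T (S y) < r n < S y]; the two remaining inequalities
   place both [T y] and [T (S y)] in []q n, r n[]. *)
pose B n := G `&` S @^-1` G `&` [set y | y < q n] `&` [set y | q n < T y] `&`
  [set y | T y < r n] `&` [set y | q n < T (S y)] `&` [set y | T (S y) < r n] `&`
  [set y | r n < S y].
have mpre A : measurable A -> measurable (S @^-1` A).
  by move=> mA; rewrite -[_ @^-1` _]setTI; exact: measurable_funP.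
have mTS : measurable_fun setT (T \o S) by exact: measurableT_comp.
have mB n : measurable (B n).
  do 6 (apply: measurableI; last by apply: measurable_ltr_set).
  by apply: measurableI => //; exact: mpre.
pose C := seqDU B.
have mC n : measurable (C n) by apply: measurableD => //; exact: bigsetU_measurable.
have CB n : C n `<=` B n by exact: subDsetl.
have UCB : \bigcup_n C n = \bigcup_n B n by rewrite -seqDU_bigcup_eq.
have mUC : measurable (\bigcup_n C n) by exact: bigcupT_measurable.
have mpos : measurable [set y | 0 < u y] by exact: measurable_ltr_set.
have mneg : measurable [set y | u y < 0] by exact: measurable_ltr_set.
have null_density (l : {finite_measure set R -> \bar R}) (f : R -> R) A :
    (forall A, l A = \int[nu]_(x in A) (f x)%:E)%E ->
    (forall y, A y -> f y = 0) -> l A = 0%E.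
  by move=> lE f0; rewrite lE integral0_eq// => y /f0 ->.
(* [lp] lives where [u > 0] and its image [lm] where [u < 0]. So outside an [lp]-null set [y < T y]
   and [T (S y) < S y], and monotonicity of [T] on [G] applied to [y <= S y] completes the chain in
   which the rationals are chosen. *)
have lpC : lp (~` \bigcup_n C n) = 0%E.
  pose null (A : set R) := measurable A /\ lp A = 0%E.
  have nullU A A' : null A -> null A' -> null (A `|` A').
    by move=> [? ?] [? ?]; split; [exact: measurableU|exact: null_set_setU].
  have n1 : null (~` GS) by split => //; exact: measurableC.
  have n2 : null (~` G).
    by split; [|apply: dom lpE _ _ _ => //]; exact: measurableC.
  have n3 : null (S @^-1` (~` G)).
    have mGC := measurableC mG; split; first exact: mpre.
    by rewrite SE//; apply: dom lmE _ _ _.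
  have n4 : null (~` [set y | 0 < u y]).
    split; first exact: measurableC.
    apply: (null_density _ up) => // y /= /negP; rewrite -leNgt => u0.
    exact/max_idPr.
  have n5 : null (S @^-1` (~` [set y | u y < 0])).
    split; first by apply: mpre; exact: measurableC.
    rewrite SE; last exact: measurableC.
    apply: (null_density _ um) => // y /= /negP; rewrite -leNgt => u0.
    by apply/max_idPr; rewrite oppr_le0.
  have [mN N0] := nullU _ _ (nullU _ _ (nullU _ _ (nullU _ _ n1 n2) n3) n4) n5.
  apply: (subset_measure0 _ mN _ N0); first exact: measurableC.
  move=> y; apply: contra_notP; rewrite UCB => /not_orP[].
  move=> /not_orP[/not_orP[/not_orP[/contrapT GSy /contrapT Gy] /contrapT GSSy]].
  move=> /contrapT; rewrite /= /u subr_gt0 => yTy /contrapT /=.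
  rewrite /= subr_lt0 => SyTSy.
  have TS : T y <= T (S y) by apply: ndT; rewrite ?inE//; exact: Sge.
  have [a] := rat_in_itvoo yTy; rewrite in_itv/= => /andP[ya aT].
  have [b] := rat_in_itvoo SyTSy; rewrite in_itv/= => /andP[Tb bS].
  exists (pickle (a, b)) => //; rewrite /B /q /r pickleK/=; do !split => //=.
    exact: le_lt_trans TS Tb.
  exact: lt_le_trans aT TS.
have intS f A : (forall x, 0 <= f x)%E -> measurable_fun setT f -> measurable A ->
    (\int[lp]_(y in S @^-1` A) f (S y) = \int[lm]_(z in A) f z)%E.
  move=> f0 mf mA; rewrite -(@ge0_integral_pushforward _ _ _ _ _ S)//.
  - by apply: eq_measure_integral => E mE' _; exact: SE.
  - exact: measurable_funTS.
have intp A : measurable A ->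
    (\int[lp]_(y in A) (kp y)%:E = nu (A `&` [set y | (0 < u y)%R]))%E.
  move=> mA; rewrite lpI//; last exact: mE.
  under eq_integral do rewrite /= -EFinM kpM.
  rewrite setIC -integral_indic//; apply: eq_integral => y _.
  rewrite indicE; congr ((nat_of_bool _)%:R%:E).
  by apply/idP/idP => [?|/set_mem//]; exact/mem_set.
have intm A : measurable A ->
    (\int[lm]_(y in A) (km y)%:E = nu (A `&` [set y | (u y < 0)%R]))%E.
  move=> mA; rewrite lmI//; last exact: mE.
  under eq_integral do rewrite /= -EFinM kmM.
  rewrite setIC -integral_indic//; apply: eq_integral => y _.
  rewrite indicE; congr ((nat_of_bool _)%:R%:E).
  by apply/idP/idP => [?|/set_mem//]; exact/mem_set.
have sumC f A : (forall x, 0 <= f x)%E -> measurable_fun setT f -> measurable A ->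
    (\sum_(0 <= n <oo) \int[lp]_(y in C n `&` A) f y = \int[lp]_(y in A) f y)%E.
  move=> f0 mf mA.
  rewrite (@ge0_negligible_integral _ _ _ _ A (~` \bigcup_n C n))//; last 2 first.
  - exact: measurableC.
  - exact: measurable_funTS.
  rewrite setDE setCK setIC setI_bigcupl ge0_integral_bigcup//.
  - by move=> n; exact: measurableI.
  - exact: measurable_funTS.
  - by apply: trivIset_setIr; exact: trivIset_seqDU.
pose idm : {mfun R >-> R} := mfun_of (@measurable_id _ R setT).
have kpoo : (\int[lp]_y (kp (idm y))%:E < +oo)%E.
  by rewrite intp// ltey_eq fin_num_measure//; exact: measurableI.
have kmoo : (\int[lp]_y (km (S y))%:E < +oo)%E.
  have -> := intS (EFin \o km) setT (fun x => km0 x) (mE _ mkm) measurableT.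
  by rewrite intm// ltey_eq fin_num_measure//; exact: measurableI.
have kp0E y : (0 <= (EFin \o kp) y)%E by rewrite lee_fin.
have km0E y : (0 <= (EFin \o km) y)%E by rewrite lee_fin.
have [al /all_and2[alE alI]] := choice (fun n =>
  @weighted_image_measure R lp _ idm _ (mC n) kp0E (mE _ mkp) kpoo).
have [be /all_and2[beE beI]] := choice (fun n =>
  @weighted_image_measure R lp _ S _ (mC n) km0E (mE _ mkm) kmoo).
exists q, r, al, be; split.
- move=> A mA; rewrite nneseriesD//.
  have mkmS : measurable_fun setT (EFin \o (km \o S)).
    by apply: mE; exact: measurableT_comp.
  have -> : (\sum_(0 <= n <oo) al n A = nu (A `&` [set y | (0 < u y)%R]))%E.
    rewrite (eq_eseriesr (fun n _ => alE n A mA)).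
    exact: (etrans (sumC _ A kp0E (mE _ mkp) mA) (intp A mA)).
  have -> : (\sum_(0 <= n <oo) be n A = nu (A `&` [set y | (u y < 0)%R]))%E.
    rewrite (eq_eseriesr (fun n _ => beE n A mA)).
    apply: (etrans (sumC _ (S @^-1` A) (fun y => km0E (S y)) mkmS (mpre _ mA))).
    exact: (etrans (intS _ A km0E (mE _ mkm) mA) (intm A mA)).
  rewrite (measureDI nu mA mpos) (measureDI nu (measurableD mA mpos) mneg).
  rewrite -addeA [X in (_ + X = _)%E]addeC; congr (nu _ + (_ + nu _))%E.
    apply/seteqP; split => y /=; rewrite /u.
      by move=> [[Ay /negP P] /negP N]; split => //; lra.
    by move=> [Ay Ty]; split; [split => //|]; rewrite Ty subrr ltxx.
  apply/seteqP; split => y /= => [[[Ay _] yN]|[Ay yN]]; split => //; split => //.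
  by apply/negP; rewrite -leNgt ltW.
- move=> n; rewrite alE; last first.
    apply: measurableC.
    exact: (@measurable_ltr_set3 R G id (cst (q n)) (cst (q n)) T T (cst (r n))).
  rewrite (_ : _ `&` _ = set0) ?integral_set0//.
  apply/seteqP; split => // y [/CB By]; apply.
  by move: By => [[[[[[[? ?] ?] ?] ?] ?] ?] ?]; split.
- move=> n; rewrite beE; last first.
    apply: measurableC.
    exact: (@measurable_ltr_set3 R G (cst (r n)) id (cst (q n)) T T (cst (r n))).
  rewrite (_ : _ `&` _ = set0) ?integral_set0//.
  apply/seteqP; split => // y [/CB By]; apply.
  by move: By => [[[[[[[? ?] ?] ?] ?] ?] ?] ?]; split.
- move=> n; have up0E y : (0 <= (EFin \o up) y)%E by rewrite lee_fin.
  have um0E y : (0 <= (EFin \o um) y)%E by rewrite lee_fin.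
  under [RHS]eq_integral do rewrite -opprB.
  apply: (etrans (alI n _ up0E (mE _ mup))).
  apply: (etrans _ (esym (beI n _ um0E (mE _ mum)))).
  apply: eq_integral => y /set_mem/CB[[[[[[[_ _] /= yq] /= qT] _] _] /= Tr] /= rS].
  (* On [C n] the point [y] has [u > 0] and [S y] has [u < 0], so each density cancels against its
     inverse and both integrands are 1. *)
  rewrite -!EFinM [up _ * _]mulrC [um _ * _]mulrC kpM kmM /u.
  have -> : 0 < T y - y by lra.
  by have -> : T (S y) - S y < 0 by lra.
Qed.

End matched_decomposition.

(** * Mixture kernels and their martingales *)

Section probability_of.
Context d (T : measurableType d) (R : realType).
Variable m : {measure set T -> \bar R}.
Hypothesis m1 : m setT = 1%E.

Let pm : set T -> \bar R := m.

Let pm1 : pm setT = 1%E. Proof. exact: m1. Qed.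

HB.instance Definition _ := Measure.on pm.
HB.instance Definition _ := @Measure_isProbability.Build _ _ _ pm pm1.

Lemma probability_of :
  exists P : probability T R, forall A, P A = m A.
Proof. by exists pm. Qed.

End probability_of.

(** A composition of kernels out of a one-point space: draw [x] from [mu], then [y] from [K x], and
    record the pair by a Dirac mass. *)
Lemma kernel_product (R : realType) (mu : probability R R) (K : R.-pker R ~> R) :
  exists P : probability (R * R)%type R,
    forall g, (forall z, 0 <= g z)%E -> measurable_fun setT g ->
      (\int[P]_z g z = \int[mu]_x \int[K x]_y g (x, y))%E.
Proof.
pose l : R.-sfker unit ~> R :=
  kprobability (measurable_cst (mu : pprobability R R) : measurable_fun [set: unit] _).
pose k : R.-sfker (unit * R) ~> R := @kernel.kernel_snd _ _ _ unit R R R K.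
have mj : measurable_fun setT (fun z : unit * R * R => (z.1.2, z.2)).
  apply/measurable_fun_pairP; split => /=.
    exact: (measurableT_comp measurable_snd measurable_fst).
  exact: measurable_snd.
pose j : R.-sfker (unit * R * R) ~> (R * R)%type := @kdirac _ _ _ _ R _ mj.
have PI g : (forall z, 0 <= g z)%E -> measurable_fun setT g ->
    (\int[mkcomp l (mkcomp k j) tt]_z g z = \int[mu]_x \int[K x]_y g (x, y))%E.
  move=> g0 mg; rewrite integral_kcomp//; apply: eq_integral => x _.
  rewrite integral_kcomp//; apply: eq_integral => y _.
  by rewrite integral_dirac// diracT mul1e.
have [P PE] : exists P : probability (R * R)%type R,
    forall A, P A = mkcomp l (mkcomp k j) tt A.
  apply: probability_of.
  have := PI (cst 1%E) (fun=> lee01) (measurable_cst _).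
  rewrite integral_cst// mul1e => ->.
  rewrite (eq_integral (cst 1%E)).
    by rewrite integral_cst// mul1e; have := @probability_setT _ _ _ mu.
  by move=> x _; rewrite integral_cst// mul1e prob_kernel.
exists P => g g0 mg; rewrite -PI//.
by apply: eq_measure_integral => A mA _; exact: PE.
Qed.

Section mixture_kernel.
Context {R : realType}.
Variables (al be : nat -> {finite_measure set R -> \bar R}).
Variables (c e : nat -> R -> R).
Hypotheses (c0 : forall n x, 0 <= c n x) (e0 : forall n x, 0 <= e n x).
Hypotheses (mc : forall n, measurable_fun setT (c n))
           (me : forall n, measurable_fun setT (e n)).
Variable G : set R.
Hypothesis mG : measurable G.
Hypothesis mass1 : forall x, G x ->
  (\sum_(0 <= n <oo) ((c n x)%:E * al n setT + (e n x)%:E * be n setT) = 1)%E.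

Let piece (x : R) (n : nat) : {measure set R -> \bar R} :=
  measure_add (mscale (NngNum (c0 n x)) (al n)) (mscale (NngNum (e0 n x)) (be n)).

Let mixture (x : R) : {measure set R -> \bar R} := mseries (piece x) 0.

Let pieceI x n f A : measurable A -> (forall y, 0 <= f y)%E ->
  measurable_fun setT f ->
  (\int[piece x n]_(y in A) f y = (c n x)%:E * \int[al n]_(y in A) f y +
    (e n x)%:E * \int[be n]_(y in A) f y)%E.
Proof.
move=> mA f0 mf; have mfA := measurable_funTS (D := A) mf.
by rewrite ge0_integral_measure_add// !ge0_integral_mscale.
Qed.

(** The Dirac value off [G] serves a double purpose in the application: it is the intended law at
    the fixed points, and it keeps [K] a probability kernel on the null set where the weights fail
    to sum to 1. *)
Let K (x : R) : {measure set R -> \bar R} :=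
  if x \in G then mixture x else dirac x.

Let mixtureE x A : measurable A ->
  (mixture x A = \sum_(0 <= n <oo)
    ((c n x)%:E * al n A + (e n x)%:E * be n A))%E.
Proof.
move=> mA; apply: eq_eseriesr => n _.
exact: (measure_addE (mscale (NngNum (c0 n x)) (al n)) (mscale (NngNum (e0 n x)) (be n))).
Qed.

Let mK U : measurable U -> measurable_fun setT (K ^~ U).
Proof.
move=> mU; rewrite (_ : K ^~ U = fun x => if x \in G then
  (\sum_(0 <= n <oo) ((c n x)%:E * al n U + (e n x)%:E * be n U))%E
  else (\d_x U)); last first.
  by apply/funext => x; rewrite /K; case: ifPn => // _; exact: mixtureE.
apply: measurable_fun_ifT.
- apply: (measurable_fun_bool true); rewrite setTI.
  by rewrite (_ : _ @^-1` _ = G)//; apply/seteqP; split => y /= => [/set_mem|/mem_set].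
- apply: ge0_emeasurable_sum => [n x _ _|n _].
    by rewrite adde_ge0// mule_ge0// lee_fin.
  by apply: emeasurable_funD; apply: emeasurable_funM => //; exact/measurable_EFinP.
- exact: measurable_fun_dirac.
Qed.

HB.instance Definition _ := isKernel.Build _ _ _ _ _ K mK.

Let K1 x : K x setT = 1%E.
Proof.
rewrite /K; case: ifPn => [/set_mem Gx|_]; last exact: diracT.
by rewrite mixtureE// mass1.
Qed.

HB.instance Definition _ := Kernel_isProbability.Build _ _ _ _ _ K K1.

Lemma mixture_kernel : exists k : R.-pker R ~> R,
  [/\ forall x, ~ G x -> forall A, k x A = \d_x A,
      forall x A, G x -> measurable A ->
        (k x A = \sum_(0 <= n <oo)
          ((c n x)%:E * al n A + (e n x)%:E * be n A))%E &
      forall x f, G x -> (forall y, 0 <= f y)%E -> measurable_fun setT f ->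
        (\int[k x]_y f y = \sum_(0 <= n <oo) ((c n x)%:E * \int[al n]_y f y +
          (e n x)%:E * \int[be n]_y f y))%E].
Proof.
exists K; split => [x Gx A|x A Gx mA|x f Gx f0 mf] /=.
- by rewrite /K memNset.
- by rewrite /K mem_set// mixtureE.
- rewrite /K mem_set// ge0_integral_measure_series//.
  by apply: eq_eseriesr => n _; rewrite pieceI.
Qed.

End mixture_kernel.

Section martingale_of_mixture.
Context {R : realType} (mu nu : probability R R).
Hypothesis mu_int : mu.-integrable setT (EFin \o (fun x : R => x)).
Hypothesis nu_int : nu.-integrable setT (EFin \o (fun x : R => x)).
Variable D : set R.
Hypothesis mD : measurable D.
Variables (al be : nat -> {finite_measure set R -> \bar R}).
Variables (f c e : nat -> R -> R).
Hypotheses (f0 : forall n x, 0 <= f n x) (c0 : forall n x, 0 <= c n x)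
           (e0 : forall n x, 0 <= e n x).
Hypotheses (mf : forall n, measurable_fun setT (f n))
           (mc : forall n, measurable_fun setT (c n))
           (me : forall n, measurable_fun setT (e n)).
Hypothesis mass : forall n x,
  ((c n x)%:E * al n setT + (e n x)%:E * be n setT = (f n x)%:E)%E.
(** This is the barycentre identity for the [n]-th pair at [x], with the negative parts moved across
    so that every term is nonnegative. *)
Hypothesis mean : forall n x,
  ((c n x)%:E * \int[al n]_y (Num.max y 0)%:E +
   (e n x)%:E * \int[be n]_y (Num.max y 0)%:E + (f n x * Num.max (- x) 0)%:E =
   (c n x)%:E * \int[al n]_y (Num.max (- y) 0)%:E +
   (e n x)%:E * \int[be n]_y (Num.max (- y) 0)%:E + (f n x * Num.max x 0)%:E)%E.
(** The weight has integral 1 unless [al n] is the zero measure; the product form covers both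
    cases. *)
Hypothesis al_mass : forall n B, measurable B ->
  ((\int[mu]_x (c n x)%:E) * al n B = al n B)%E.
Hypothesis be_mass : forall n B, measurable B ->
  ((\int[mu]_x (e n x)%:E) * be n B = be n B)%E.
Hypothesis fD : forall n x, D x -> c n x = 0 /\ e n x = 0.
Hypothesis f1 : {ae mu, forall x, ~ D x -> (\sum_(0 <= n <oo) (f n x)%:E = 1)%E}.
Hypothesis al_ac : forall n B, measurable B ->
  lebesgue_measure B = 0%E -> al n B = 0%E.
Hypothesis be_ac : forall n B, measurable B ->
  lebesgue_measure B = 0%E -> be n B = 0%E.
Hypothesis nuE : forall B, measurable B ->
  (nu B = mu (B `&` D) + \sum_(0 <= n <oo) (al n B + be n B))%E.

Let G := [set x | ~ D x /\ (\sum_(0 <= n <oo) (f n x)%:E = 1)%E].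

Let mEFin (g : R -> R) : measurable_fun setT g -> measurable_fun setT (EFin \o g).
Proof. by move=> ?; exact/measurable_EFinP. Qed.

Let mG : measurable G.
Proof.
rewrite (_ : G = ~` D `&`
    [set x | (\sum_(0 <= n <oo) (f n x)%:E)%E = 1%E])//.
apply: measurableI; first exact: measurableC.
have mS : measurable_fun setT (fun x => \sum_(0 <= n <oo) (f n x)%:E)%E.
  apply: ge0_emeasurable_sum => [n x _ _|n _]; first by rewrite lee_fin.
  exact: mEFin.
have := mS measurableT [set 1%E] (emeasurable_set1 _).
by rewrite setTI.
Qed.

Let Gmass x : G x ->
  (\sum_(0 <= n <oo) ((c n x)%:E * al n setT + (e n x)%:E * be n setT) = 1)%E.
Proof. by move=> [_ <-]; apply: eq_eseriesr => n _; exact: mass. Qed.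

(** [X] and [Y] are the coordinates of the plane under the law that draws [x] from [mu] and [y] from
    [K x], where [K] is the mixture on [G] and Dirac elsewhere. The law of [Y] follows by
    integrating the weights, and the martingale property from the barycentre of [K x] at each
    [x]. *)
Lemma martingale_of_mixture :
  exists (d : measure_display) (T : measurableType d) (P : probability T R)
         (X Y : {mfun T >-> R}),
    same_measure (distribution P X) mu /\
    same_measure (distribution P Y) nu /\
    cond_exp_is_X P X Y /\
    exists K : R.-pker R ~> R,
      cond_distribution P X Y K /\
      {ae mu, forall x : R,
         same_measure (K x) (\d_x) \/ K x `<< (@lebesgue_measure R)}.
Proof.
have [K [Kd KG KI]] := mixture_kernel c0 e0 mc me mG Gmass.
have [P PI] := kernel_product mu K.
pose X : {mfun (R * R)%type >-> R} := 
    mfun_of (measurable_fst : measurable_fun setT (@fst R R)).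
pose Y : {mfun (R * R)%type >-> R} := 
    mfun_of (measurable_snd : measurable_fun setT (@snd R R)).
have mX A : measurable A -> measurable (X @^-1` A).
  by move=> mA; rewrite -[_ @^-1` _]setTI; exact: measurable_funP.
have mY A : measurable A -> measurable (Y @^-1` A).
  by move=> mA; rewrite -[_ @^-1` _]setTI; exact: measurable_funP.
have PIA g A : (forall z, 0 <= g z)%E -> measurable_fun setT g -> measurable A ->
    (\int[P]_(w in X @^-1` A) g w = \int[mu]_(x in A) \int[K x]_y g (x, y))%E.
  move=> g0 mg mA; rewrite integral_mkcond PI; last 2 first.
  - by move=> z; rewrite patchE; case: ifP.
  - by apply/(measurable_restrictT _ (mX _ mA)); exact: measurable_funTS.
  rewrite [RHS]integral_mkcond; apply: eq_integral => x _; rewrite patchE.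
  case: ifPn => xA.
    apply: eq_integral => y _; rewrite patchE mem_set//.
    exact: set_mem xA.
  apply: integral0_eq => y _; rewrite patchE memNset// => Ax.
  by move/negP: xA; apply; exact: mem_set.
have Kcst x (k : \bar R) : (0 <= k)%E -> (\int[K x]_y k = k)%E.
  by move=> k0; rewrite integral_cst// prob_kernel mule1.
have PX : same_measure (distribution P X) mu.
  move=> A mA; rewrite /distribution /pushforward.
  have := PIA (cst 1%E) A (fun=> lee01) (measurable_cst _) mA.
  rewrite integral_cst ?mul1e; last exact: mX.
  move=> ->; rewrite (eq_integral (cst 1%E)) ?integral_cst ?mul1e//.
  by move=> x _; exact: Kcst.
have PAB A B : measurable A -> measurable B ->
    (P (X @^-1` A `&` Y @^-1` B) = \int[mu]_(x in A) K x B)%E.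
  move=> mA mB.
  have mI : measurable_fun setT (fun w => (\1_(Y @^-1` B) w)%:E : \bar R).
    by apply/measurable_EFinP; apply: measurable_indic; exact: mY.
  have := PIA _ A (fun w => _) mI mA.
  rewrite integral_indic//; [|exact: mX|exact: mY].
  rewrite setIC => ->; last by move=> w; rewrite lee_fin.
  apply: eq_integral => x _.
  have := integral_indic (K x) measurableT mB; rewrite setIT => <-.
  by apply: eq_integral.
have aeN : exists2 N, measurable N & mu N = 0%E /\ ~` N `<=` G `|` D.
  have [N [mN N0 NP]] := f1; exists N => //; split => // x.
  move=> Nx; apply: contrapT => /not_orP[Gx Dx]; apply: Nx; apply: NP => /=.
  by move=> /(_ Dx) fx; apply: Gx.
have [N mN [N0 NGD]] := aeN.
have PY : same_measure (distribution P Y) nu.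
  move=> B mB; rewrite /distribution /pushforward.
  have := PAB setT B measurableT mB; rewrite preimage_setT setTI => ->.
  pose h x := (\sum_(0 <= n <oo) ((c n x)%:E * al n B + (e n x)%:E * be n B))%E.
  have mce n : measurable_fun setT
      (fun x => (c n x)%:E * al n B + (e n x)%:E * be n B)%E.
    by apply: emeasurable_funD; apply: emeasurable_funM => //; exact: mEFin.
  have ce0 n x : (0 <= (c n x)%:E * al n B + (e n x)%:E * be n B)%E.
    by rewrite adde_ge0// mule_ge0// lee_fin.
  have mh : measurable_fun setT h by apply: ge0_emeasurable_sum.
  have h0 x : (0 <= h x)%E by exact: nneseries_ge0.
  have mI : measurable_fun setT (fun x => (\1_(B `&` D) x)%:E : \bar R).
    by apply: mEFin; apply: measurable_indic; exact: measurableI.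
  (* On [G] the kernel is the mixture and the indicator vanishes; on [D] the weights vanish and the
     kernel is Dirac. The null set [N] absorbs the other points. *)
  transitivity (\int[mu]_x (h x + (\1_(B `&` D) x)%:E))%E.
    apply: ge0_ae_eq_integral => //.
    - exact: measurable_kernel.
    - exact: emeasurable_funD.
    - by move=> x _; rewrite adde_ge0.
    - exists N; split => //= x /= Nx; apply: contrapT => /NGD GD; apply: Nx => _.
      case: GD => [Gx|Dx].
        rewrite KG// indicE memNset ?adde0// => -[_ Dx].
        by case: Gx.
      have nGx : ~ G x by case.
      rewrite Kd// /h eseries0 ?add0e; last first.
        by move=> n _ _; have [-> ->] := fD n Dx; rewrite !mul0e add0e.
      rewrite diracE indicE; congr ((nat_of_bool _)%:R%:E).
      by apply/idP/idP => [/set_mem Bx|/set_mem[Bx _]]; exact/mem_set.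
  rewrite ge0_integralD// integral_indic//; last exact: measurableI.
  rewrite setIT addeC nuE//; congr (_ + _)%E.
  rewrite integral_nneseries//; apply: eq_eseriesr => n _.
  rewrite ge0_integralD//; first last.
  - by apply: emeasurable_funM => //; exact: mEFin.
  - by move=> x _; rewrite mule_ge0// lee_fin.
  - by apply: emeasurable_funM => //; exact: mEFin.
  - by move=> x _; rewrite mule_ge0// lee_fin.
  rewrite ge0_integralZr//; [|exact: mEFin|by move=> x _; rewrite lee_fin].
  rewrite ge0_integralZr//; [|exact: mEFin|by move=> x _; rewrite lee_fin].
  by rewrite al_mass// be_mass.
exists _, (R * R)%type, P, X, Y; split => //; split => //; split; last first.
  exists K; split.
    move=> A B mA mB; rewrite PAB// (PIA (fun w => K (X w) B))//; last first.
      exact: (measurableT_comp (measurable_kernel K _ mB)).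
    by apply: eq_integral => x _; apply: esym; exact: (Kcst x (K x B) (measure_ge0 _ _)).
  apply: aeW => x; have [Gx|Gx] := pselect (G x); [right|left].
    apply/null_content_dominatesP => B mB B0; rewrite KG//.
    by apply: eseries0 => n _ _; rewrite al_ac// be_ac// !mule0 adde0.
  by move=> A mA; exact: Kd.
have [iX _] := integrable_distribution PX mu_int.
have [iY _] := integrable_distribution PY nu_int.
split; [exact: iX|split; [exact: iY|]] => A mA.
pose p (x : R) : R := Num.max x 0; pose m (x : R) : R := Num.max (- x) 0.
have p0 x : 0 <= p x by rewrite le_max lexx orbT.
have m0 x : 0 <= m x by rewrite le_max lexx orbT.
have mp : measurable_fun setT p by exact: measurable_maxr.
have mm : measurable_fun setT m by apply: measurable_maxr => //; exact: measurable_funN.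
have pm x : p x - m x = x by rewrite /p /m /Num.max; case: ifPn; case: ifPn; lra.
have KcstD (g : R -> R) (k x : R) :
    (forall y, 0 <= g y) -> measurable_fun setT g -> 0 <= k -> G x ->
    (\int[K x]_y (g y + k)%:E = \sum_(0 <= n <oo)
      ((c n x)%:E * \int[al n]_y (g y)%:E +
       (e n x)%:E * \int[be n]_y (g y)%:E + (f n x * k)%:E))%E.
  move=> g0 mg k0 Gx; have mgE := mEFin mg.
  have g0E y : (0 <= (EFin \o g) y)%E by rewrite lee_fin.
  under eq_integral do rewrite EFinD.
  rewrite ge0_integralD//; last by move=> y _; rewrite lee_fin.
  rewrite Kcst ?lee_fin//.
  (* The densities sum to 1 on [G], so the constant can be distributed over the pieces and matched
     term by term with [mean]. *)
  have -> : k%:E = (\sum_(0 <= n <oo) (f n x * k)%:E)%E.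
    under eq_eseriesr do rewrite mulrC EFinM.
    rewrite nneseriesZl//; last by move=> n _; rewrite lee_fin.
    by case: Gx => _ ->; rewrite mule1.
  rewrite (KI x _ Gx g0E mgE) -nneseriesD//.
  - by move=> n _ _; rewrite adde_ge0// mule_ge0// ?lee_fin// integral_ge0.
  - by move=> n _ _; rewrite lee_fin mulr_ge0.
(* The identity [y^+ + x^- = y^- + x^+] in mean avoids subtraction: both sides could a priori be
   infinite at a given [x]. They become finite after integration, by integrability of [X] and [Y],
   and are subtracted only then. *)
have Kmean x : (\int[K x]_y (p y + m x)%:E = \int[K x]_y (m y + p x)%:E)%E.
  have [Gx|Gx] := pselect (G x).
    by rewrite !KcstD//; apply: eq_eseriesr => n _; exact: mean.
  have Kdirac (g : R -> R) : measurable_fun setT g ->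
      (\int[K x]_y (g y)%:E = (g x)%:E)%E.
    move=> mg; transitivity (\int[\d_x]_y (g y)%:E)%E.
      by apply: eq_measure_integral => B mB _; exact: Kd.
    by rewrite integral_dirac// ?diracT ?mul1e//; exact: mEFin.
  rewrite !Kdirac; first by rewrite addrC.
  - exact: measurable_funD.
  - exact: measurable_funD.
have iS (g : R -> R) (Z : {mfun (R * R)%type >-> R}) :
    (forall x, 0 <= g x) -> (forall x, g x <= `|x|) -> measurable_fun setT g ->
    P.-integrable setT (EFin \o Z) -> P.-integrable (X @^-1` A) (EFin \o (g \o Z)).
  move=> g0 gle mg iZ.
  apply: (@integrableS _ _ _ _ setT) => //; first exact: mX.
  apply: (le_integrable _ _ _ iZ) => //.
    by apply/measurable_EFinP; exact: measurableT_comp.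
  by move=> w _ /=; rewrite lee_fin ger0_norm.
have ple x : p x <= `|x| by rewrite ge_max normr_ge0 andbT ler_norm.
have mle x : m x <= `|x| by rewrite ge_max normr_ge0 andbT -normrN ler_norm.
have iF : P.-integrable (X @^-1` A) (EFin \o (fun w => p (Y w) + m (X w))).
  rewrite (_ : EFin \o _ = (EFin \o (p \o Y)) \+ (EFin \o (m \o X)))%E//.
  by apply: integrableD => //; [exact: mX|exact: iS|exact: iS].
have iH : P.-integrable (X @^-1` A) (EFin \o (fun w => m (Y w) + p (X w))).
  rewrite (_ : EFin \o _ = (EFin \o (m \o Y)) \+ (EFin \o (p \o X)))%E//.
  by apply: integrableD => //; [exact: mX|exact: iS|exact: iS].
have FH : (\int[P]_(w in X @^-1` A) (p (Y w) + m (X w))%:E =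
           \int[P]_(w in X @^-1` A) (m (Y w) + p (X w))%:E)%E.
  rewrite (PIA (fun w => (p (Y w) + m (X w))%:E))//; first last.
  - by apply/measurable_EFinP; apply: measurable_funD; exact: measurableT_comp.
  - by move=> w; rewrite lee_fin addr_ge0.
  rewrite (PIA (fun w => (m (Y w) + p (X w))%:E))//; first last.
  - by apply/measurable_EFinP; apply: measurable_funD; exact: measurableT_comp.
  - by move=> w; rewrite lee_fin addr_ge0.
  by apply: eq_integral => x _; exact: Kmean.
have iXA : P.-integrable (X @^-1` A) (EFin \o X).
  by apply: (@integrableS _ _ _ _ setT) => //; exact: mX.
have iYA : P.-integrable (X @^-1` A) (EFin \o Y).
  by apply: (@integrableS _ _ _ _ setT) => //; exact: mX.
have : (\int[P]_(w in X @^-1` A) (Y w - X w)%:E = 0)%E.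
  transitivity (\int[P]_(w in X @^-1` A)
      ((p (Y w) + m (X w)) - (m (Y w) + p (X w)))%:E)%E.
    apply: eq_integral => w _; congr EFin.
    by have := pm (Y w); have := pm (X w); lra.
  rewrite integralB_EFin//; last exact: mX.
  rewrite FH subee//; exact: (integrable_fin_num (mX _ mA) iH).
rewrite integralB_EFin//; last exact: mX.
have fX := integrable_fin_num (mX _ mA) iXA.
have fY := integrable_fin_num (mX _ mA) iYA.
rewrite /comp /= in fX fY.
by move=> /eqP; rewrite sube_eq ?add0e ?fin_num_adde_defl// => /eqP.
Qed.

End martingale_of_mixture.

(** * Splitting weights and densities *)

Section Rintegral_finite_measure.
Context {R : realType} (m : {finite_measure set R -> \bar R}).

Lemma finite_measure_integrable_affine (g : R -> R) (u v : R) :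
  m.-integrable setT (EFin \o g) ->
  m.-integrable setT (EFin \o (fun y => u * g y + v)).
Proof.
move=> ig.
rewrite (_ : EFin \o _ = (fun y => u%:E * (EFin \o g) y) \+ (EFin \o cst v))%E//.
apply: integrableD => //; first exact: integrableZl.
exact: (@finite_measure_integrable_cst _ _ _ m setT v measurableT).
Qed.

Lemma Rintegral_affine (g : R -> R) (u v : R) :
  m.-integrable setT (EFin \o g) ->
  \int[m]_y (u * g y + v) = u * \int[m]_y g y + v * fine (m setT).
Proof.
move=> ig; rewrite RintegralD//; last 2 first.
- have := finite_measure_integrable_affine u 0 ig.
  by apply: eq_integrable => // y _; rewrite /= addr0.
- exact: (@finite_measure_integrable_cst _ _ _ m setT v measurableT).
by rewrite RintegralZl// Rintegral_cst.
Qed.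

Variable E : set R.
Hypotheses (mE : measurable E) (E0 : m (~` E) = 0%E).

Lemma Rintegral_ge0_ae (g : R -> R) : m.-integrable setT (EFin \o g) ->
  (forall y, E y -> 0 <= g y) -> 0 <= \int[m]_y g y.
Proof.
move=> ig g0; rewrite /Rintegral.
rewrite (@negligible_integral _ _ _ _ setT (~` E))//; last exact: measurableC.
rewrite setTD setCK; apply: fine_ge0; apply: integral_ge0 => y Ey.
by rewrite lee_fin g0.
Qed.

Lemma eq_Rintegral_ae (g h : R -> R) : m.-integrable setT (EFin \o g) ->
  m.-integrable setT (EFin \o h) ->
  (forall y, E y -> g y = h y) -> \int[m]_y g y = \int[m]_y h y.
Proof.
move=> ig ih gh; apply/eqP; rewrite -subr_eq0 -RintegralB//.
have igh : m.-integrable setT (EFin \o (fun y => g y - h y)).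
  rewrite (_ : EFin \o _ = (EFin \o g) \- (EFin \o h))%E//; exact: integrableB.
have ihg : m.-integrable setT (EFin \o (fun y => h y - g y)).
  rewrite (_ : EFin \o _ = (EFin \o h) \- (EFin \o g))%E//; exact: integrableB.
rewrite eq_le; apply/andP; split.
  rewrite RintegralB// -oppr_ge0 opprB -RintegralB//.
  by apply: Rintegral_ge0_ae => // y Ey; rewrite gh// subrr.
by apply: Rintegral_ge0_ae => // y Ey; rewrite gh// subrr.
Qed.

Lemma measure0_Rintegral0 (g : R -> R) : m.-integrable setT (EFin \o g) ->
  (forall y, 0 <= g y) -> (forall y, E y -> 0 < g y) -> \int[m]_y g y = 0 ->
  m setT = 0%E.
Proof.
move=> ig g0 Eg g00.
have mg : measurable_fun setT (EFin \o g) by exact: measurable_int ig.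
have : (\int[m]_y `|(EFin \o g) y| = 0)%E.
  under eq_integral do rewrite gee0_abs ?lee_fin//.
  rewrite -[LHS]fineK; first by congr EFin.
  exact: (integrable_fin_num _ ig).
move=> /(ae_eq_integral_abs m measurableT mg)[N [mN N0 gN]].
apply: (@subset_measure0 _ _ _ _ _ (N `|` ~` E)) => //.
- by apply: measurableU => //; exact: measurableC.
- move=> y _; have [Ey|] := pselect (E y); [left|by right].
  apply: gN => /(_ I) [] /eqP; rewrite gt_eqF//; exact: Eg.
- by apply: null_set_setU => //; exact: measurableC.
Qed.

End Rintegral_finite_measure.

Section bridge_weights.
Context {R : realType} (al be : {finite_measure set R -> \bar R}).
Variables (T : R -> R) (q r : R) (Ea Eb : set R).
Hypotheses (ial : al.-integrable setT (EFin \o (fun y : R => y)))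
           (ibe : be.-integrable setT (EFin \o (fun y : R => y))).
Hypotheses (iTal : al.-integrable setT (EFin \o T))
           (iTbe : be.-integrable setT (EFin \o T)).
Hypotheses (mEa : measurable Ea) (mEb : measurable Eb).
Hypotheses (Ea0 : al (~` Ea) = 0%E) (Eb0 : be (~` Eb) = 0%E).
Hypothesis Eaq : forall y, Ea y -> [/\ y < q, q < T y & T y < r].
Hypothesis Ebr : forall y, Eb y -> [/\ r < y, q < T y & T y < r].
Hypothesis balance : (\int[al]_y (Num.max (T y - y) 0)%:E =
                      \int[be]_y (Num.max (y - T y) 0)%:E)%E.

Let a := fine (al setT).
Let b := fine (be setT).
Let A1 := \int[al]_y y.
Let B1 := \int[be]_y y.

Let imax (m : {finite_measure set R -> \bar R}) (g : R -> R) :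
  m.-integrable setT (EFin \o g) ->
  m.-integrable setT (EFin \o (fun y => Num.max (g y) 0)).
Proof.
move=> ig; have mg : measurable_fun setT g.
  by apply/measurable_EFinP; exact: measurable_int ig.
apply: (le_integrable _ _ _ ig) => //.
  by apply/measurable_EFinP; exact: measurable_maxr.
move=> y _ /=; rewrite lee_fin ger0_norm ?le_max ?lexx ?orbT//.
by rewrite ge_max normr_ge0 andbT ler_norm.
Qed.

Let isub (m : {finite_measure set R -> \bar R}) (g h : R -> R) :
  m.-integrable setT (EFin \o g) -> m.-integrable setT (EFin \o h) ->
  m.-integrable setT (EFin \o (fun y => g y - h y)).
Proof.
move=> ig ih.
rewrite (_ : EFin \o _ = (EFin \o g) \- (EFin \o h))%E//; exact: integrableB.
Qed.

Let Rbalance : \int[al]_y Num.max (T y - y) 0 = \int[be]_y Num.max (y - T y) 0.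
Proof. by rewrite /Rintegral balance. Qed.

(** [T] moves points of [Ea] to the right and those of [Eb] to the left, so the positive parts in
    the balance are the differences themselves: [T] preserves the first moment of [al + be]. *)
Let Tbalance : \int[al]_y T y - A1 = B1 - \int[be]_y T y.
Proof.
rewrite -RintegralB// -RintegralB//.
rewrite (@eq_Rintegral_ae _ al Ea _ _ _ (fun y => Num.max (T y - y) 0))//.
- rewrite Rbalance; apply: (@eq_Rintegral_ae _ be Eb) => //; [exact/imax/isub|exact: isub|].
  by move=> y /Ebr[? ? ?]; apply/max_idPl; lra.
- exact: isub.
- exact/imax/isub.
- by move=> y /Eaq[? ? ?]; apply/esym/max_idPl; lra.
Qed.

Let max0 (x : R) : 0 <= Num.max x 0. Proof. by rewrite le_max lexx orbT. Qed.

Let al0P : al setT = 0%E \/ 0 < a.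
Proof.
have [->|al0] := eqVneq (al setT) 0%E; [by left|right].
by rewrite fine_gt0// lt0e al0 measure_ge0/= ltey_eq fin_num_measure.
Qed.

Let be0P : be setT = 0%E \/ 0 < b.
Proof.
have [->|be0] := eqVneq (be setT) 0%E; [by left|right].
by rewrite fine_gt0// lt0e be0 measure_ge0/= ltey_eq fin_num_measure.
Qed.

Let Rint0 (m : {finite_measure set R -> \bar R}) (g : R -> R) :
  m.-integrable setT (EFin \o g) -> m setT = 0%E -> \int[m]_y g y = 0.
Proof.
move=> ig m0; rewrite /Rintegral null_set_integral//.
exact: measurable_int ig.
Qed.

(** If [al] vanishes, the balance forces a function that is strictly positive on [Eb] to have
    integral 0 against [be]. *)
Let al0be0 : al setT = 0%E -> be setT = 0%E.
Proof.
move=> al0; apply: (@measure0_Rintegral0 _ be Eb _ _ (fun y => Num.max (y - T y) 0)) => //.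
- exact/imax/isub.
- by move=> y /Ebr[? ? ?]; rewrite lt_max; apply/orP; left; lra.
- by rewrite -Rbalance Rint0//; exact/imax/isub.
Qed.

Let be0al0 : be setT = 0%E -> al setT = 0%E.
Proof.
move=> be0; apply: (@measure0_Rintegral0 _ al Ea _ _ (fun y => Num.max (T y - y) 0)) => //.
- exact/imax/isub.
- by move=> y /Eaq[? ? ?]; rewrite lt_max; apply/orP; left; lra.
- by rewrite Rbalance Rint0//; exact/imax/isub.
Qed.

(** The barycentre of [al] is at most [q] and that of [be] at least [r], so any [x] in between is a
    combination of the two with affine weights. The affine function behind [l] integrates to 1
    against [al] and 0 against [be], the one behind [s] to 0 and 1. Since [T] preserves mass and
    first moment of [al + be], composing with [T] keeps these totals. *)
Lemma bridge_weights : (al setT = 0%E /\ be setT = 0%E) \/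
  exists l s : R -> R,
  [/\ measurable_fun setT l /\ measurable_fun setT s,
      forall x, 0 <= l x /\ 0 <= s x,
      forall x, q < x -> x < r -> l x * a + s x * b = 1,
      forall x, q < x -> x < r -> l x * A1 + s x * B1 = x &
      (\int[al]_y (l (T y))%:E + \int[be]_y (l (T y))%:E = 1)%E /\
      (\int[al]_y (s (T y))%:E + \int[be]_y (s (T y))%:E = 1)%E].
Proof.
have [al0|a0] := al0P; first by left; split => //; exact: al0be0.
have [be0|b0] := be0P; first by left; split => //; exact: be0al0.
right.
have A1q : A1 <= q * a.
  have := @Rintegral_ge0_ae _ al Ea mEa Ea0 (fun y => -1 * y + q).
  rewrite Rintegral_affine// -/a -/A1 => H.
  have {}H : 0 <= -1 * A1 + q * a.
    apply: H; first exact: finite_measure_integrable_affine.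
    by move=> y /Eaq[]; lra.
  lra.
have rB1 : r * b <= B1.
  have := @Rintegral_ge0_ae _ be Eb mEb Eb0 (fun y => 1 * y - r).
  rewrite Rintegral_affine// -/b -/B1 => H.
  have {}H : 0 <= 1 * B1 - r * b.
    rewrite -mulNr; apply: H; first exact: finite_measure_integrable_affine.
    by move=> y /Ebr[]; lra.
  lra.
(* If [r <= q] then [Ea] is empty, against the positive mass of [al]. *)
have [qr|rq] := ltP q r; last first.
  exfalso; have : al setT = 0%E.
    rewrite -Ea0; congr (al _); apply/seteqP; split => // y _ /Eaq[]; lra.
  by move=> al0; move: a0; rewrite /a al0 ltxx.
(* [l] and [s] solve [l a + s b = 1], [l A1 + s B1 = x] by Cramer's rule. *)
pose Det := a * B1 - b * A1.
have Det0 : 0 < Det.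
  have := mulr_gt0 (mulr_gt0 a0 b0) (_ : 0 < r - q).
  have := ler_wpM2l (ltW a0) rB1; have := ler_wpM2l (ltW b0) A1q.
  rewrite /Det => H1 H2 H3; have {}H3 : 0 < a * b * (r - q) by apply: H3; lra.
  lra.
pose l0 x := - b / Det * x + B1 / Det.
pose s0 x := a / Det * x + - A1 / Det.
have l00 x : x < r -> 0 <= l0 x.
  move=> xr; rewrite /l0 -mulrAC -mulrDl divr_ge0 ?(ltW Det0)//.
  have := ler_wpM2l (ltW b0) (ltW xr); lra.
have s00 x : q < x -> 0 <= s0 x.
  move=> qx; rewrite /s0 -mulrAC -mulrDl divr_ge0 ?(ltW Det0)//.
  have := ler_wpM2l (ltW a0) (ltW qx); lra.
have Detn0 : Det != 0 by rewrite gt_eqF.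
pose AT := \int[al]_y T y; pose BT := \int[be]_y T y.
have mT (u v : R) : measurable_fun setT (fun x : R => Num.max (u * x + v) 0).
  by apply: measurable_maxr => //; exact: measurable_funD.
have RT (m : {finite_measure set R -> \bar R}) E (u v : R) : measurable E ->
    m (~` E) = 0%E -> m.-integrable setT (EFin \o T) ->
    (forall y, E y -> 0 <= u * T y + v) ->
    (\int[m]_y (Num.max (u * T y + v) 0)%:E =
     (u * \int[m]_y T y + v * fine (m setT))%:E)%E.
  move=> mE E0 iT uv0.
  have iuv := finite_measure_integrable_affine u v iT.
  rewrite -Rintegral_affine// -(@eq_Rintegral_ae _ m E mE E0
    (fun y => Num.max (u * T y + v) 0))//.
  - by rewrite /Rintegral fineK//; exact: (integrable_fin_num _ (imax iuv)).
  - exact: imax.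
  - by move=> y /uv0 ?; apply/max_idPl.
(* Truncation at 0 makes the weights nonnegative everywhere and changes nothing on []q, r[], which
   contains the images of [Ea] and [Eb] under [T]. *)
exists (fun x => Num.max (l0 x) 0), (fun x => Num.max (s0 x) 0); split.
- by split; exact: mT.
- by move=> x; split; exact: max0.
- move=> x qx xr; rewrite !(max_idPl _) ?l00 ?s00// /l0 /s0.
  apply: (mulfI Detn0); rewrite mulr1 /Det; field; exact: Detn0.
- move=> x qx xr; rewrite !(max_idPl _) ?l00 ?s00// /l0 /s0.
  apply: (mulfI Detn0); rewrite /Det; field; exact: Detn0.
- have TB := Tbalance; rewrite -/AT -/BT in TB.
  split.
    rewrite (RT al Ea)//; last by move=> y /Eaq[_ _ /l00].
    rewrite (RT be Eb)//; last by move=> y /Ebr[_ _ /l00].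
    rewrite -EFinD; congr EFin; rewrite -/a -/b -/AT -/BT.
    have -> : BT = A1 + B1 - AT by lra.
    apply: (mulfI Detn0); rewrite mulr1 /Det; field; exact: Detn0.
  rewrite (RT al Ea)//; last by move=> y /Eaq[_ /s00].
  rewrite (RT be Eb)//; last by move=> y /Ebr[_ /s00].
  rewrite -EFinD; congr EFin; rewrite -/a -/b -/AT -/BT.
  have -> : BT = A1 + B1 - AT by lra.
  apply: (mulfI Detn0); rewrite mulr1 /Det; field; exact: Detn0.
Qed.

End bridge_weights.

(** The Radon-Nikodym derivative is cut down to [E] and made real valued, so that it vanishes at
    every point off [E] and later identities hold without exceptional sets. *)
Lemma finite_measure_density (R : realType) (mu : probability R R)
    (m : {finite_measure set R -> \bar R}) (E : set R) :
  measurable E -> m (~` E) = 0%E ->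
  (forall A, measurable A -> (m A <= mu A)%E) ->
  exists f : R -> R,
  [/\ measurable_fun setT f, forall x, 0 <= f x, forall x, ~ E x -> f x = 0,
      forall A, measurable A -> (m A = \int[mu]_(x in A) (f x)%:E)%E &
      forall g, (forall x, 0 <= g x)%E -> measurable_fun setT g ->
        (\int[mu]_x (g x * (f x)%:E) = \int[m]_x g x)%E].
Proof.
move=> mE E0 mmu; have mdom : m `<< mu.
  apply/null_content_dominatesP => A mA A0; apply/eqP.
  by rewrite -measure_le0 -A0; exact: mmu.
pose k := Radon_Nikodym_SigmaFinite.f m mu.
have mk : measurable_fun setT k.
  exact: (measurable_int _ (Radon_Nikodym_SigmaFinite.f_integrable mdom)).
have k0 : forall x, (0 <= k x)%E := Radon_Nikodym_SigmaFinite.f_ge0 mdom.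
have kfin : forall x, k x \is a fin_num := Radon_Nikodym_SigmaFinite.f_fin_num mdom.
have kI A : measurable A -> (m A = \int[mu]_(x in A) k x)%E.
  exact: Radon_Nikodym_SigmaFinite.f_integral.
have fE x : (((fine \o k) \_ E) x)%:E = (k \_ E) x.
  by rewrite !patchE; case: ifP => // _; rewrite /= fineK.
exists ((fine \o k) \_ E); split.
- apply/measurable_EFinP; rewrite (_ : EFin \o _ = k \_ E); last exact/funext.
  by apply/(measurable_restrictT _ mE); exact: measurable_funTS.
- by move=> x; rewrite patchE; case: ifP => // _; exact: fine_ge0.
- by move=> x Ex; rewrite patchE memNset.
- move=> A mA; under eq_integral do rewrite fE.
  rewrite -integral_mkcondr -kI; last exact: measurableI.
  rewrite (measureDI m mA mE) [X in (X + _)%E](_ : _ = 0%E) ?add0e//.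
  apply: (subset_measure0 _ _ _ E0); last by move=> x [].
  + exact: measurableD.
  + exact: measurableC.
- move=> g g0 mg; under eq_integral do rewrite fE.
  have -> : (\int[m]_x g x = \int[m]_(x in E) g x)%E.
    rewrite (@ge0_negligible_integral _ _ _ _ setT (~` E))//; last exact: measurableC.
    by rewrite setTD setCK.
  rewrite -(Radon_Nikodym_SigmaFinite.change_of_variables mdom g0 mE); last first.
    exact: measurable_funTS.
  rewrite [RHS]integral_mkcond; apply: eq_integral => x _.
  by rewrite !patchE; case: ifP => // _; rewrite mule0.
Qed.

Lemma image_add_measure (R : realType) (al be : {finite_measure set R -> \bar R})
    (T : {mfun R >-> R}) :
  exists m : {finite_measure set R -> \bar R},
    (forall A, measurable A -> m A = al (T @^-1` A) + be (T @^-1` A))%E /\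
    forall g, (forall x, 0 <= g x)%E -> measurable_fun setT g ->
      (\int[m]_x g x = \int[al]_y g (T y) + \int[be]_y g (T y))%E.
Proof.
have mT : measurable_fun setT T by [].
have image (h : {finite_measure set R -> \bar R}) :
    exists h' : {finite_measure set R -> \bar R},
      forall A, h' A = pushforward h T A.
  apply: finite_measure_of.
  have : (h setT < +oo)%E by rewrite ltey_eq fin_num_measure.
  exact.
have imageI (h h' : {finite_measure set R -> \bar R}) g :
    (forall A, h' A = pushforward h T A) -> (forall x, 0 <= g x)%E ->
    measurable_fun setT g -> (\int[h']_x g x = \int[h]_y g (T y))%E.
  move=> h'E g0 mg; transitivity (\int[pushforward h T]_x g x)%E.
    by apply: eq_measure_integral => A mA _; exact: h'E.
  by rewrite ge0_integral_pushforward// preimage_setT.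
have [alT alTE] := image al; have [beT beTE] := image be.
pose m0 : {measure set R -> \bar R} := measure_add alT beT.
have m0E A : (m0 A = al (T @^-1` A) + be (T @^-1` A))%E.
  by rewrite [LHS](measure_addE alT beT) alTE beTE.
have [m mE] : exists m : {finite_measure set R -> \bar R}, forall A, m A = m0 A.
  apply: finite_measure_of; rewrite m0E preimage_setT.
  by rewrite ltey_eq fin_numD !fin_num_measure.
exists m; split => [A mA|g g0 mg]; first by rewrite mE m0E.
transitivity (\int[m0]_x g x)%E.
  by apply: eq_measure_integral => A mA _; exact: mE.
by rewrite ge0_integral_measure_add// (imageI _ _ _ alTE)// (imageI _ _ _ beTE).
Qed.

Section bridge_densities.
Context {R : realType} (mu : probability R R).
Variables (al be : {finite_measure set R -> \bar R}).
Variables (T : {mfun R >-> R}) (q r : R) (Ea Eb D : set R).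
Hypotheses (ial : al.-integrable setT (EFin \o (fun y : R => y)))
           (ibe : be.-integrable setT (EFin \o (fun y : R => y))).
Hypotheses (iTal : al.-integrable setT (EFin \o T))
           (iTbe : be.-integrable setT (EFin \o T)).
Hypotheses (mEa : measurable Ea) (mEb : measurable Eb).
Hypotheses (Ea0 : al (~` Ea) = 0%E) (Eb0 : be (~` Eb) = 0%E).
Hypothesis Eaq : forall y, Ea y -> [/\ y < q, q < T y & T y < r].
Hypothesis Ebr : forall y, Eb y -> [/\ r < y, q < T y & T y < r].
Hypothesis balance : (\int[al]_y (Num.max (T y - y) 0)%:E =
                      \int[be]_y (Num.max (y - T y) 0)%:E)%E.
Hypothesis mD : measurable D.
Hypothesis EaD : forall y, Ea y -> ~ D (T y).
Hypothesis EbD : forall y, Eb y -> ~ D (T y).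
Hypothesis le_mu : forall A, measurable A ->
  (al (T @^-1` A) + be (T @^-1` A) <= mu A)%E.

(** [f] is the density of the image of [al + be] under [T] with respect to [mu], and [c = l f],
    [e = s f]. As [f] vanishes off []q, r[] and on [D], the affine identities give mass and mean at
    every [x]. The integrals of [c] and [e] are those of [l] and [s] against the image measure,
    hence 1; if [al] and [be] vanish, all three functions are 0. *)
Lemma bridge_densities : exists f c e : R -> R,
  [/\ [/\ measurable_fun setT f, measurable_fun setT c & measurable_fun setT e],
      forall x, [/\ 0 <= f x, 0 <= c x & 0 <= e x],
      (forall x,
        ((c x)%:E * al setT + (e x)%:E * be setT = (f x)%:E)%E) /\
      (forall x, ((c x)%:E * \int[al]_y (Num.max y 0)%:E +
        (e x)%:E * \int[be]_y (Num.max y 0)%:E + (f x * Num.max (- x) 0)%:E =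
        (c x)%:E * \int[al]_y (Num.max (- y) 0)%:E +
        (e x)%:E * \int[be]_y (Num.max (- y) 0)%:E + (f x * Num.max x 0)%:E)%E),
      (forall B, measurable B -> ((\int[mu]_x (c x)%:E) * al B = al B)%E) /\
      (forall B, measurable B -> ((\int[mu]_x (e x)%:E) * be B = be B)%E) &
      (forall x, D x -> c x = 0 /\ e x = 0) /\
      (forall A, measurable A ->
        (\int[mu]_(x in A) (f x)%:E = al (T @^-1` A) + be (T @^-1` A))%E)].
Proof.
have mpre A : measurable A -> measurable (T @^-1` A).
  by move=> mA; rewrite -[_ @^-1` _]setTI; exact: measurable_funP.
have [[al0 be0]|] := bridge_weights ial ibe iTal iTbe mEa mEb Ea0 Eb0 Eaq Ebr balance.
  have null (m : {finite_measure set R -> \bar R}) A :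
      m setT = 0%E -> measurable A -> m A = 0%E.
    by move=> m0 mA; apply: (subset_measure0 _ _ _ m0).
  exists (cst 0), (cst 0), (cst 0); split => //.
  - by split => x; rewrite /= ?mul0r ?mul0e ?add0e.
  - by split => B mB; [rewrite (null al _ al0 mB)|rewrite (null be _ be0 mB)];
      rewrite mule0.
  - split => // A mA; rewrite (null al _ al0 (mpre _ mA)).
    by rewrite (null be _ be0 (mpre _ mA)) adde0 integral0_eq.
move=> [l [s [[ml ms] ls0 ls1 lsx [l1 s1]]]].
pose E := `]q, r[%classic `&` ~` D.
have mE : measurable E by apply: measurableI => //; exact: measurableC.
have [m [mE' mI]] := image_add_measure al be T.
have E0 : m (~` E) = 0%E.
  rewrite mE'; last exact: measurableC.
  have mTE : measurable (T @^-1` (~` E)) by apply: mpre; exact: measurableC.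
  rewrite (subset_measure0 mTE (measurableC mEa) _ Ea0); last first.
    move=> y TE Ey; apply: TE; split; last exact: EaD.
    by have [? qT Tr] := Eaq Ey; rewrite /= in_itv/= qT.
  rewrite (subset_measure0 mTE (measurableC mEb) _ Eb0) ?adde0//.
  move=> y TE Ey; apply: TE; split; last exact: EbD.
  by have [? qT Tr] := Ebr Ey; rewrite /= in_itv/= qT.
have mmu A : measurable A -> (m A <= mu A)%E by move=> mA; rewrite mE'//; exact: le_mu.
have [f [mf f0 fE fI fg]] := finite_measure_density mE E0 mmu.
have fqr x : f x = 0 \/ q < x /\ x < r.
  have [[+ _]|/fE] := pselect (E x); last by left.
  by rewrite /= in_itv/= => /andP; right.
exists f, (fun x => l x * f x), (fun x => s x * f x); split.
- by split => //; exact: measurable_funM.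
- by move=> x; have [? ?] := ls0 x; split => //; exact: mulr_ge0.
- split => x.
    rewrite -(fineK (fin_num_measure al _ measurableT)).
    rewrite -(fineK (fin_num_measure be _ measurableT)) -!EFinM -EFinD.
    congr EFin; have [->|[qx xr]] := fqr x; first by rewrite !mulr0 !mul0r addr0.
    by rewrite -[RHS]mul1r -(ls1 x qx xr); ring.
  have maxfin (h : {finite_measure set R -> \bar R}) (g : R -> R) :
      h.-integrable setT (EFin \o (fun y : R => y)) ->
      (forall y, `|g y| <= `|y|) -> measurable_fun setT g ->
      h.-integrable setT (EFin \o g).
    move=> ih gle mg; apply: (le_integrable _ _ _ ih) => //.
      exact/measurable_EFinP.
    by move=> y _ /=; rewrite lee_fin.
  have mp : measurable_fun setT (fun y : R => Num.max y 0) by exact: measurable_maxr.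
  have mn : measurable_fun setT (fun y : R => Num.max (- y) 0).
    by apply: measurable_maxr => //; exact: measurable_funN.
  have ple (y : R) : `|Num.max y 0| <= `|y|.
    by rewrite ger0_norm ?le_max ?lexx ?orbT// ge_max normr_ge0 ler_norm.
  have nle (y : R) : `|Num.max (- y) 0| <= `|y|.
    rewrite ger0_norm ?le_max ?lexx ?orbT// ge_max normr_ge0 andbT.
    by rewrite -normrN ler_norm.
  have pn (y : R) : Num.max y 0 - Num.max (- y) 0 = y.
    by rewrite /Num.max; case: ifPn; case: ifPn; lra.
  have mean (h : {finite_measure set R -> \bar R}) :
      h.-integrable setT (EFin \o (fun y : R => y)) ->
      \int[h]_y y = \int[h]_y Num.max y 0 - \int[h]_y Num.max (- y) 0.
    move=> ih; rewrite -RintegralB//; first last.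
    - exact: (maxfin _ _ ih nle mn).
    - exact: (maxfin _ _ ih ple mp).
    by apply: eq_Rintegral => y _; exact/esym/pn.
  have fin (h : {finite_measure set R -> \bar R}) (g : R -> R) :
      h.-integrable setT (EFin \o g) ->
      (\int[h]_y (g y)%:E = (\int[h]_y g y)%R%:E)%E.
    by move=> ig; rewrite /Rintegral fineK//; exact: (integrable_fin_num _ ig).
  rewrite (fin al _ (maxfin _ _ ial ple mp)) (fin be _ (maxfin _ _ ibe ple mp)).
  rewrite (fin al _ (maxfin _ _ ial nle mn)) (fin be _ (maxfin _ _ ibe nle mn)).
  rewrite -!EFinM -!EFinD; congr EFin.
  have [->|[qx xr]] := fqr x; first by rewrite !mulr0 !mul0r.
  have := lsx x qx xr; rewrite !mean// => H.
  apply/eqP; rewrite -subr_eq0; apply/eqP.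
  transitivity (f x * (l x *
    (\int[al]_y Num.max y 0 - \int[al]_y Num.max (- y) 0) +
    s x * (\int[be]_y Num.max y 0 - \int[be]_y Num.max (- y) 0) -
    (Num.max x 0 - Num.max (- x) 0))); first by ring.
  by rewrite H pn subrr mulr0.
- have c1 (g : R -> R) : (forall x, 0 <= g x) -> measurable_fun setT g ->
      (\int[al]_y (g (T y))%:E + \int[be]_y (g (T y))%:E = 1)%E ->
      (\int[mu]_x (g x * f x)%:E = 1)%E.
    move=> g0 mg <-; under eq_integral do rewrite EFinM.
    rewrite (fg (EFin \o g)); [|by move=> x; rewrite lee_fin|exact/measurable_EFinP].
    rewrite mI//; exact/measurable_EFinP.
  split => B mB; rewrite c1 ?mul1e//; by move=> x; have [] := ls0 x.
- split => [x Dx|A mA]; last by rewrite -fI// mE'.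
  by rewrite fE ?mulr0// => -[].
Qed.

End bridge_densities.

(** * Assembling the coupling from the convex order *)

Section convex_order_coupling.
Context {R : realType} (mu nu : probability R R).
Hypothesis mu_int : mu.-integrable setT (EFin \o (fun x : R => x)).
Hypothesis nu_int : nu.-integrable setT (EFin \o (fun x : R => x)).
Hypothesis nu_ac : nu `<< (@lebesgue_measure R).
Hypothesis cx : convex_order mu nu.

(** Once each pair [al n], [be n] has its weights, it remains to see that the masses add up: [mu] on
    [D] is the part of [nu] fixed by [T], and the densities [f n] sum to 1 almost everywhere off
    [D]. *)
Lemma convex_order_coupling :
  exists (d : measure_display) (T : measurableType d) (P : probability T R)
         (X Y : {mfun T >-> R}),
    same_measure (distribution P X) mu /\
    same_measure (distribution P Y) nu /\
    cond_exp_is_X P X Y /\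
    exists K : R.-pker R ~> R,
      cond_distribution P X Y K /\
      {ae mu, forall x : R,
         same_measure (K x) (\d_x) \/ K x `<< (@lebesgue_measure R)}.
Proof.
have nu0 A : measurable A -> lebesgue_measure A = 0%E -> nu A = 0%E.
  by move: A; apply/null_content_dominatesP.
have nu1 x : nu [set x] = 0%E by apply: nu0 => //; exact: lebesgue_measure_set1.
have munu : nu setT = mu setT by rewrite !probability_setT.
have [T [G [mG intG nuG ndT [Tmu _]]]] := monotone_transport munu nu1.
have [q [r [al [be [nuE al0 be0 bal]]]]] :=
  matched_decomposition mu_int nu_int nu1 cx mG nuG ndT Tmu.
have mT : measurable_fun setT T by [].
have mpre A : measurable A -> measurable (T @^-1` A).
  by move=> mA; rewrite -[_ @^-1` _]setTI; exact: measurable_funP.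
(* [D] is the set of fixed points of [T] that are not values of [T] on a
   nondegenerate interval; off a [nu]-null set it is its own preimage. *)
pose s n : R := if @unpickle rat n is Some x then ratr x else 0.
pose TQ : set R := \bigcup_n [set T (s n)].
have mTQ : measurable TQ by exact: bigcupT_measurable.
have nuTQ : nu TQ = 0%E.
  apply/(negligibleP _ mTQ); apply: negligible_bigcup => n.
  by apply/negligibleP => //; exact: nu1.
pose F := [set y | T y = y].
have mF : measurable F.
  have -> : F = ~` ([set y | T y < y] `|` [set y | y < T y]).
    apply/seteqP; split => y /=; first by rewrite /F /= => ->; rewrite ltxx => -[].
    by move=> /not_orP[/negP + /negP]; rewrite -!leNgt /F /=; lra.
  by apply: measurableC; apply: measurableU; exact: measurable_ltr_set.
pose D := G `&` F `&` ~` TQ.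
have mD : measurable D.
  by apply: measurableI; [exact: measurableI|exact: measurableC].
have preD y : G y -> D (T y) -> T y = y.
  move=> Gy [[GTy TTy] TQn]; apply: contrapT => Tyy; apply: TQn.
  (* As [T y] is itself fixed, [y] and [T y] are two points of [G] with the same image. The monotone
     [T] is constant between them, so it takes this value at a rational, and the value lies in
     [TQ]. *)
  have between a b : G a -> G b -> T a = T y -> T b = T y -> a < b -> TQ (T y).
    move=> Ga Gb Ta Tb ab.
    have [z] := rat_in_itvoo ab; rewrite in_itv/= => /andP[az zb].
    exists (pickle z) => //=; rewrite /s pickleK.
    have Gz : G (ratr z) by apply: (intG a b) => //; rewrite !ltW.
    have Taz : T a <= T (ratr z) by apply: ndT; rewrite ?inE ?ltW.
    have Tzb : T (ratr z) <= T b by apply: ndT; rewrite ?inE ?ltW.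
    by apply/eqP; rewrite eq_le -{1}Ta Taz/= (le_trans Tzb)// Tb.
  have [lt|lt|eq] := ltgtP y (T y); last by rewrite -eq in Tyy.
    exact: (between y (T y)).
  exact: (between (T y) y).
have muD B : measurable B -> mu (B `&` D) = nu (B `&` F).
  move=> mB; have mBD : measurable (B `&` D) by exact: measurableI.
  have mBF : measurable (B `&` F) by exact: measurableI.
  have E1 : nu (T @^-1` (B `&` D)) = nu (B `&` D).
    rewrite (measureDI nu (mpre _ mBD) mG) [X in (X + _)%E](_ : _ = 0%E); last first.
      apply: (subset_measure0 _ _ _ nuG); last by move=> x [].
      - by apply: measurableD => //; exact: mpre.
      - exact: measurableC.
    rewrite add0e; congr (nu _); apply/seteqP; split => y /=.
      by move=> [[BTy DTy] Gy]; rewrite -(preD y Gy DTy).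
    by move=> [By [[Gy Ty] TQy]]; rewrite Ty.
  apply: (etrans (esym (Tmu _ mBD))); apply: (etrans E1).
  rewrite (measureDI nu mBF (measurableI _ _ mG (measurableC mTQ))).
  rewrite [X in _ = (X + _)%E](_ : _ = 0%E) ?add0e; last first.
    apply: (@subset_measure0 _ _ _ _ _ (~` G `|` TQ)).
    - apply: measurableD => //; apply: measurableI => //; exact: measurableC.
    - by apply: measurableU => //; exact: measurableC.
    - move=> y [_ /not_andP[|/contrapT]]; [by left|by right].
    - by apply: null_set_setU => //; exact: measurableC.
  by congr (nu _); rewrite /D setIA [G `&` F]setIC !setIA.
have le_nu (h : {finite_measure set R -> \bar R}) (g : R -> R) :
    (forall A, measurable A -> h A <= nu A)%E ->
    nu.-integrable setT (EFin \o g) -> h.-integrable setT (EFin \o g).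
  move=> hnu /integrableP[mg goo]; apply/integrableP; split => //.
  apply: le_lt_trans goo; apply: ge0_le_measure_integral => //.
  exact: measurableT_comp.
have albe_le A n : measurable A -> (al n A + be n A <= nu A)%E.
  move=> mA; rewrite (nuE A mA) (@nneseriesD1 _ _ n)//.
    rewrite [leRHS]addeCA leeDl// adde_ge0//.
    by apply: nneseries_ge0 => k _ _; rewrite adde_ge0.
  by move=> k _; rewrite adde_ge0.
have al_le n A : measurable A -> (al n A <= nu A)%E.
  by move=> mA; apply: le_trans (albe_le A n mA); rewrite leeDl.
have be_le n A : measurable A -> (be n A <= nu A)%E.
  by move=> mA; apply: le_trans (albe_le A n mA); rewrite leeDr.
have iT : nu.-integrable setT (EFin \o T).
  have sameT : same_measure (distribution nu T) mu by move=> A mA; exact: Tmu.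
  by have [] := integrable_distribution sameT mu_int.
pose Ea n := [set y | G y /\ [/\ y < q n, q n < T y & T y < r n]].
pose Eb n := [set y | G y /\ [/\ r n < y, q n < T y & T y < r n]].
have mEa n : measurable (Ea n).
  exact: (@measurable_ltr_set3 R G id (cst (q n)) (cst (q n)) T T (cst (r n))).
have mEb n : measurable (Eb n).
  exact: (@measurable_ltr_set3 R G (cst (r n)) id (cst (q n)) T T (cst (r n))).
have EaD n y : Ea n y -> ~ D (T y).
  by move=> [Gy [yq qT _]] /(preD y Gy) Ty; move: qT; rewrite Ty ltNge ltW.
have EbD n y : Eb n y -> ~ D (T y).
  by move=> [Gy [ry _ Tr]] /(preD y Gy) Ty; move: Tr; rewrite Ty ltNge ltW.
have le_mu n A : measurable A ->
    (al n (T @^-1` A) + be n (T @^-1` A) <= mu A)%E.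
  by move=> mA; rewrite -Tmu//; apply: albe_le; exact: mpre.
have dens n := bridge_densities (le_nu _ _ (al_le n) nu_int)
  (le_nu _ _ (be_le n) nu_int) (le_nu _ _ (al_le n) iT) (le_nu _ _ (be_le n) iT)
  (mEa n) (mEb n) (al0 n) (be0 n) (fun y Ey => proj2 Ey) (fun y Ey => proj2 Ey)
  (bal n) mD (EaD n) (EbD n) (le_mu n).
have [f fP] := choice dens; have [c cP] := choice fP; have [e eP] := choice cP.
have f0 n x : 0 <= f n x by have [_ /(_ x)[]] := eP n.
have c0 n x : 0 <= c n x by have [_ /(_ x)[]] := eP n.
have e0 n x : 0 <= e n x by have [_ /(_ x)[]] := eP n.
have mf n : measurable_fun setT (f n) by have [[]] := eP n.
have mc n : measurable_fun setT (c n) by have [[]] := eP n.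
have me n : measurable_fun setT (e n) by have [[]] := eP n.
apply: (@martingale_of_mixture R mu nu mu_int nu_int D mD al be f c e) => //.
- by move=> n; have [_ _ []] := eP n.
- by move=> n; have [_ _ []] := eP n.
- by move=> n; have [_ _ _ []] := eP n.
- by move=> n; have [_ _ _ []] := eP n.
- by move=> n x; have [_ _ _ _ [/(_ x)]] := eP n.
- have mS : measurable_fun setT (fun x => \sum_(0 <= n <oo) (f n x)%:E)%E.
    apply: ge0_emeasurable_sum => [n x _ _|n _]; first by rewrite lee_fin.
    exact/measurable_EFinP.
  (* Equality of integrals over every [A]: [nuE] at the preimage of [A] splits [mu A] into [mu] of
     the part of [A] in [D] and the integrals of the [f n], and the first term, being finite,
     cancels. *)
  have : ae_eq mu setT (EFin \o \1_(~` D))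
      (fun x => \sum_(0 <= n <oo) (f n x)%:E)%E.
    apply: integral_ae_eq => // [|A _ mA].
      by have := integrable_indic mu (measurableC mD).
    rewrite integral_indic//; last exact: measurableC.
    rewrite integral_nneseries//; last 2 first.
    - by move=> n; apply: measurable_funTS; exact/measurable_EFinP.
    - by move=> n x _; rewrite lee_fin.
    under eq_eseriesr.
      move=> n _; have [_ _ _ _ [_ /(_ A mA) ->]] := eP n.
      over.
    have := nuE _ (mpre _ mA).
    have -> : T @^-1` A `&` F = A `&` F.
      by apply/seteqP; split => y /= [+ Fy]; rewrite Fy.
    rewrite -muD// Tmu// (measureDI mu mA mD) [RHS]addeC => E1.
    have fD : mu (A `&` D) \is a fin_num by apply: fin_num_measure; exact: measurableI.
    rewrite [~` D `&` A]setIC -setDE; apply: (etrans (esym (addeK _ fD))).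
    by rewrite E1 addeK.
  by apply: filterS => x /(_ I) <- Dx; rewrite /= indicE mem_set.
- move=> n B mB B0; apply/eqP; rewrite -measure_le0 -(nu0 B)//; exact: al_le.
- move=> n B mB B0; apply/eqP; rewrite -measure_le0 -(nu0 B)//; exact: be_le.
- by move=> B mB; rewrite muD//; exact: nuE.
Qed.

End convex_order_coupling.

Theorem theorem2 (R : realType) (mu nu : probability R R)
    (mu_int : mu.-integrable setT (EFin \o (fun x : R => x)))
    (nu_int : nu.-integrable setT (EFin \o (fun x : R => x)))
    (nu_ac : nu `<< (@lebesgue_measure R)) :
  convex_order mu nu <->
  exists (d : measure_display) (T : measurableType d) (P : probability T R)
         (X Y : {mfun T >-> R}),
    same_measure (distribution P X) mu /\
    same_measure (distribution P Y) nu /\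
    cond_exp_is_X P X Y /\
    exists K : R.-pker R ~> R,
      cond_distribution P X Y K /\
      {ae mu, forall x : R,
         same_measure (K x) (\d_x) \/ K x `<< (@lebesgue_measure R)}.
Proof.
split=> [cx|[d [T [P [X [Y [Xmu [Ynu [XY _]]]]]]]]].
  exact: convex_order_coupling.
exact: coupling_convex_order Xmu Ynu XY.
Qed.
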